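(* Let $A$ be a finite-dimensional unital algebra over a field $F$ of characteristic $0$, and let $V\subseteq \mathrm{LN_{alt}}(A)$ be a subsystem (a subspace closed under the triple product of $\mathrm{LN_{alt}}(A)$) such that $ab=ba$ for all $a,b\in V$. Assume that $A$ is generated by $V$ as a unital algebra. Then the Lie triple system $V$ is nilpotent, and $A$ decomposes, as a vector space, as $A=Q\oplus R$, where $R$ is a nilpotent ideal of $A$ and $Q$ is a subalgebra contained in the centre ${\rm Z}(A)$ which has no nonzero nilpotent elements.
   Context: Algebras are not necessarily associative. For an algebra $A$, $(x,y,z)=(xy)z-x(yz)$ is the associator. The left generalised alternative nucleus is $\mathrm{LN_{alt}}(A)=\{a\in A : (a,x,y)=-(x,a,y)\ \forall x,y\in A\}$; it is a Lie triple system under $[a,b,c]=a(bc)-b(ac)-c(ab)+c(ba)$. A Lie triple system (L.t.s.) is a vector space $V$ with trilinear product $[\cdot,\cdot,\cdot]$ satisfying $[a,a,b]=0$, $[a,b,c]+[b,c,a]+[c,a,b]=0$ and $[x,y,[a,b,c]]=[[x,y,a],b,c]+[a,[x,y,b],c]+[a,b,[x,y,c]]$. Lower central series: $V^0=V$, $V^1=[V,V,V]$, $V^{n+1}=[V^n,V,V]+[V,V,V^n]$; $V$ is nilpotent if $V^n=0$ for some $n$. An algebra (or ideal) $R$ is nilpotent if there is $N$ such that every product of $N$ elements of $R$, with any arrangement of parentheses, is zero. The centre ${\rm Z}(A)$ is the set of elements that commute with all elements of $A$ and lie in the left, middle and right associative nuclei (i.e. all associators involving them vanish). *)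

(* Defs.v *)
From HB Require Import structures.
From mathcomp Require Import all_boot all_order all_algebra.
Set Implicit Arguments. Unset Strict Implicit. Unset Printing Implicit Defensive.
Import GRing.Theory.
Local Open Scope ring_scope.

Section NonAssoc.
Variables (F : fieldType) (A : vectType F) (mul : A -> A -> A).

Definition bilinear_mul : Prop :=
  (forall (a : F) (x y z : A), mul (a *: x + y) z = a *: mul x z + mul y z) /\
  (forall (a : F) (x y z : A), mul x (a *: y + z) = a *: mul x y + mul x z).

Definition is_unit_elt (one : A) : Prop := forall x, mul one x = x /\ mul x one = x.

Definition assoc (x y z : A) : A := mul (mul x y) z - mul x (mul y z).

Definition in_LNalt (a : A) : Prop := forall x y, assoc a x y = - assoc x a y.

Definition trip (a b c : A) : A :=
  mul a (mul b c) - mul b (mul a c) - mul c (mul a b) + mul c (mul b a).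

(* subspace spanned by all [u1,u2,u3] with ui in Ui (by trilinearity, spanned by basis products) *)
Definition tspan (U1 U2 U3 : {vspace A}) : {vspace A} :=
  (<< flatten [seq [seq trip a b c | a <- vbasis U1, b <- vbasis U2] | c <- vbasis U3] >>)%VS.

Fixpoint lcs (V : {vspace A}) (n : nat) : {vspace A} :=
  match n with
  | 0 => V
  | n'.+1 => (tspan (lcs V n') V V + tspan V V (lcs V n'))%VS
  end.

Definition lts_nilpotent (V : {vspace A}) : Prop := exists n, lcs V n = 0%VS.

Definition mul_closed (W : {vspace A}) : Prop :=
  forall x y, x \in W -> y \in W -> mul x y \in W.

Definition generates_unital (one : A) (V : {vspace A}) : Prop :=
  forall W : {vspace A}, one \in W -> (V <= W)%VS -> mul_closed W -> W = fullv.

Definition is_ideal (R : {vspace A}) : Prop :=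
  forall r x, r \in R -> mul r x \in R /\ mul x r \in R.

Inductive is_prod (R : {vspace A}) : nat -> A -> Prop :=
  | prod_leaf r : r \in R -> is_prod R 1 r
  | prod_node m n x y : is_prod R m x -> is_prod R n y -> is_prod R (m + n) (mul x y).

Definition alg_nilpotent (R : {vspace A}) : Prop :=
  exists N, (0 < N)%N /\ forall x, is_prod R N x -> x = 0.

Definition in_centre (z : A) : Prop :=
  forall x y, mul z x = mul x z /\ assoc z x y = 0 /\ assoc x z y = 0 /\ assoc x y z = 0.

(* right powers q^(n+1) *)
Fixpoint rpow (q : A) (n : nat) : A :=
  match n with 0 => q | n'.+1 => mul q (rpow q n') end.

Definition no_nonzero_nilpotents (Q : {vspace A}) : Prop :=
  forall q, q \in Q -> (exists n, rpow q n = 0) -> q = 0.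

End NonAssoc.

(* Main.v *)
Require Import Defs.
From Stdlib Require Import Classical.
From HB Require Import structures.
From mathcomp Require Import all_boot all_order all_algebra all_field ring.
Import Order.TTheory GRing.Theory Num.Theory.
Local Open Scope ring_scope.
Set Implicit Arguments. Unset Strict Implicit. Unset Printing Implicit Defensive.

(** Write [L x] for left multiplication by [x].  For [a] in [V] the defining identity
   reads [L (a x + x a) = L a L x + L x L a], hence [L [a,b,c] = [[L a, L b], L c]], and
   [[L a, L b]] kills the unit because [a b = b a].  Finite dimension gives a linear
   relation between the values at 1 of the iterates of [X |-> L a X + X L a] on [L b];
   since [L x] is determined by its value at 1, it is a relation between operators, and
   bracketing it with [L a] and evaluating at 1 lowers its degree.  So [ad (L a)] is
   nilpotent on [L V] for every [a] in [V], and the semisimple part [s] of [a] (in the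
   sense of Jordan-Chevalley) lies in the centre.
   The elements [a - s] span a triple system N of nilpotent operators: N is orthogonal
   to central multiplications for the trace.  The trace form vanishes on N, so by
   Cartan's criterion the elements of [[N, N]] are nilpotent, and the Engel-Jacobson
   theorem makes the associative algebra generated by N nilpotent.  This yields the
   nilpotency of V and that of the ideal R generated by N; Q is the algebra of
   semisimple central elements that are diagonal in a common eigenbasis of the [s]. *)

(** The obstacle is that [L (x y)] is not [L x L y], so nilpotency of the associative algebra
    generated by the [L x] with [x] in N does not by itself bound products in [A]. For [b] in
    [LN_alt] one has [2 L (b y) = L b L y + L y L b + L (b y - y b)], and [b y - y b] is the value
    at 1 of [[L b, L y]]. If [L y] is a sum of words in letters, this bracket expands into words
    containing one [[L b, L c]]; moved to the right end it dies at 1, and what it leaves behind are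
    triple products, each counting as one letter. So the commutator needs no more letters than [y],
    and induction on the number of letters turns every [L x] into a sum of words. A second count,
    the weight, gives a triple product the sum of the weights of its factors. It is additive under
    the product of [A]; this makes the elements of weight at least 1 an ideal and bounds their
    products. *)

Lemma natf_neq0_char0 (F : fieldType) : [pchar F] =i pred0 ->
  forall n, (n.+1)%:R != 0 :> F.
Proof. by move=> /pcharf0P hF n; rewrite hF. Qed.

Lemma pchar0_rmorph (F K : fieldType) (f : {rmorphism F -> K}) :
  [pchar F] =i pred0 -> [pchar K] =i pred0.
Proof. by move=> hF p; rewrite (fmorph_pchar f). Qed.

(** * Separable polynomials and splitting fields *)

Section Polynomials.

Lemma irredp_factor (F : fieldType) (p : {poly F}) : (1 < size p)%N ->
  exists2 q, irreducible_poly q & q %| p.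
Proof.
have [k] := ubnP (size p); elim: k p => // k IH p szp p1.
case: (classic (inhabited (irreducible_poly p))) => [[irp]|nirp]; first by exists p.
have [q [q1 qp nqp]] : exists q : {poly F}, [/\ size q != 1%N, q %| p & ~~ (q %= p)].
  apply: NNPP => h; apply: nirp; split; split=> // q q1 qp.
  by case: (boolP (q %= p)) => // nqp; case: h; exists q.
have p0 : p != 0 by rewrite -size_poly_gt0 ltnW.
have q0 : q != 0 by apply: contraNneq p0 => q0; move: qp; rewrite q0 dvd0p.
have szq : (size q < size p)%N.
  by rewrite ltn_neqAle dvdp_leq // andbT dvdp_size_eqp.
have q2 : (1 < size q)%N.
  by rewrite ltn_neqAle eq_sym q1 size_poly_gt0.
have [r irr rq] := IH q (leq_trans szq szp) q2.
by exists r => //; apply: dvdp_trans qp.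
Qed.

(** Roots of irreducible factors are adjoined one at a time; recording only a field and a ring
    morphism lets the steps compose without towers of extensions. *)
Lemma splitting_field (F : fieldType) (p : {poly F}) : p != 0 ->
  exists (K : fieldType) (f : {rmorphism F -> K}) (rs : seq K),
    map_poly f p %= \prod_(r <- rs) ('X - r%:P).
Proof.
have [k] := ubnP (size p); elim: k F p => // k IH F p szp p0.
have [p1|p1] := leqP (size p) 1.
  exists F, idfun, [::]; rewrite map_poly_id // big_nil -size_poly_eq1.
  by rewrite eqn_leq p1 size_poly_gt0.
have [q irq qp] := irredp_factor p1.
have [L _ [z qz _]] := irredp_FAdjoin irq.
have pz : root (map_poly (in_alg L) p) z.
  by rewrite -dvdp_XsubCl (dvdp_trans _ (_ : map_poly (in_alg L) q %| _)) ?dvdp_map // dvdp_XsubCl.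
have /factor_theorem[s Ds] := pz.
have s0 : s != 0.
  by apply: contraNneq p0 => s0; move/eqP: Ds; rewrite s0 mul0r map_poly_eq0.
have szs : (size s < k)%N.
  have := congr1 (fun x : {poly L} => size x) Ds.
  rewrite size_map_poly size_Mmonic ?monicXsubC // size_XsubC addn2 /= => e.
  by rewrite e ltnS in szp.
have [K [f [rs frs]]] := IH L s szs s0.
exists K, (f \o in_alg L : {rmorphism F -> K}), (f z :: rs).
have -> : map_poly (f \o in_alg L) p = map_poly f (map_poly (in_alg L) p).
  by rewrite -map_poly_comp.
rewrite Ds rmorphM /= rmorphB /= map_polyX map_polyC big_cons mulrC.
by rewrite eqp_mul2l ?polyXsubC_eq0.
Qed.

(** [q] gathers each irreducible factor of [p] once. In characteristic 0 an irreducible [r] has a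
    nonzero derivative of smaller degree, to which it is therefore coprime. *)
Lemma separable_radical (F : fieldType) (p : {poly F}) : [pchar F] =i pred0 -> p != 0 ->
  exists q k, separable_poly q /\ p %| q ^+ k.
Proof.
move=> hF; have [m] := ubnP (size p); elim: m p => // m IH p szp p0.
have [p1|p1] := leqP (size p) 1.
  exists 1, 0%N; rewrite expr0 dvdp1 eqn_leq p1 size_poly_gt0; split=> //.
  by rewrite unlock /separable_poly coprime1p.
have [r irr /dvdpP[s Ds]] := irredp_factor p1.
have r1 : (1 < size r)%N by case: irr.
have r0 : r != 0 by rewrite -size_poly_gt0 ltnW.
have s0 : s != 0 by apply: contraNneq p0 => s0; rewrite Ds s0 mul0r.
have szs : (size s < m)%N.
  move: szp; rewrite Ds size_mul // -subn1 ltnS => szp.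
  apply: leq_trans szp; rewrite -(subnKC r1) add2n !addnS subn1 /= ltnS.
  by rewrite leq_addr.
have [q [k [sepq sq]]] := IH s szs s0.
have [rq|nrq] := boolP (r %| q).
  by exists q, k.+1; split=> //; rewrite Ds exprSr dvdp_mul.
exists (q * r), k.+1; split; last first.
  rewrite Ds exprMn; apply: dvdp_mul; rewrite exprSr.
    exact: dvdp_mulr.
  exact: dvdp_mull.
rewrite separable_mul sepq coprimep_sym irreducible_poly_coprime // nrq andbT /=.
rewrite unlock /separable_poly irreducible_poly_coprime //.
have r'0 : r^`() != 0.
  have e : ((size r).-2.+1 = (size r).-1)%N by case: (size r) r1 => [|[]].
  apply/eqP => /(congr1 (fun u : {poly F} => u`_(size r).-2)) /eqP.
  rewrite coef_deriv coef0 -mulr_natr mulf_eq0 (negPf (natf_neq0_char0 hF _)).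
  by rewrite e -/(lead_coef r) lead_coef_eq0 (negPf r0).
apply/negP => /(dvdp_leq r'0); rewrite leqNgt.
by rewrite lt_size_deriv.
Qed.

Lemma comp_poly_taylor1 (R : comNzRingType) (p a b : {poly R}) :
  exists r, p \Po (a + b) = p \Po a + (p^`() \Po a) * b + b ^+ 2 * r.
Proof.
elim/poly_ind: p => [|p c [r Er]].
  by exists 0; rewrite deriv0 !comp_poly0 mul0r mulr0 !addr0.
exists (r * (a + b) + (p^`() \Po a)).
rewrite !comp_poly_MXaddC Er derivD derivC derivM derivX mulr1 addr0.
rewrite comp_polyD comp_polyM comp_polyX.
ring.
Qed.

(* Newton iteration starting at ['X]. *)
Lemma newton_lift (F : fieldType) (q : {poly F}) k : separable_poly q ->
  exists g, q %| g - 'X /\ q ^+ k.+1 %| q \Po g.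
Proof.
rewrite unlock => /Bezout_eq1_coprimepP [[u v] /= Euv].
elim: k => [|k [g [qg qkg]]].
  by exists 'X; rewrite subrr dvdp0 comp_polyXr expr1.
(* Newton step, with [v] as the inverse of the derivative of [q] modulo [q]. *)
exists (g - (v \Po g) * (q \Po g)); split.
  rewrite addrAC; apply: dvdp_sub => //; apply: dvdp_mull.
  by apply: dvdp_trans qkg; rewrite exprS; apply: dvdp_mulr.
have [r ->] := comp_poly_taylor1 q g (- ((v \Po g) * (q \Po g))).
have E1 : (u \Po g) * (q \Po g) + (v \Po g) * (q^`() \Po g) = 1.
  by rewrite -!comp_polyM -comp_polyD Euv -[1]/(1%:P) comp_polyC.
have -> : q \Po g + (q^`() \Po g) * - ((v \Po g) * (q \Po g)) +
  (- ((v \Po g) * (q \Po g))) ^+ 2 * r =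
  (q \Po g) * (q \Po g) * ((u \Po g) + (v \Po g) ^+ 2 * r).
  by rewrite -[X in X + _ * - _]mulr1 -[X in _ * X + _ * - _]E1; ring.
apply: dvdp_mulr; apply: (@dvdp_trans _ (q ^+ k.+1 * q ^+ k.+1)); last exact: dvdp_mul.
by rewrite -exprD dvdp_exp2l // addSn addnS !ltnS leq_addl.
Qed.

End Polynomials.

(** * Traces, nilpotent matrices and semisimple parts *)

Section Matrices.

(** For a rank factorisation [E = C *m R], idempotence gives [R *m C = 1]; the trace is cyclic. *)
Lemma mxtrace_idem (F : fieldType) n (E : 'M[F]_n) :
  E *m E = E -> \tr E = (\rank E)%:R.
Proof.
move=> EE; have := mulmx_base E; move: (row_base_free E) (col_base_full E).
move: (\rank E) (row_base E) (col_base E) => m R C fR fC DE.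
have E1 : R *m C = 1%:M.
  have [B B1] := row_fullP fC; have [D D1] := row_freeP fR.
  have : B *m (E *m E) *m D = B *m E *m D by rewrite EE.
  by rewrite -DE !mulmxA B1 !mul1mx -!mulmxA D1 mulmx1.
by rewrite -{1}DE mxtrace_mulC E1 mxtrace1.
Qed.

(** Over a splitting field each eigenvalue is a root of the minimal polynomial, which divides a
    power of ['X]; so all eigenvalues vanish. *)
Lemma mxtrace_nilp (F : fieldType) n (X : 'M[F]_n.+1) k :
  X ^+ k = 0 -> \tr X = 0.
Proof.
move=> Xk; have c0 : char_poly X != 0 by rewrite monic_neq0 ?char_poly_monic.
have [K [f [rs frs]]] := splitting_field c0.
have Dc : map_poly f (char_poly X) = \prod_(r <- rs) ('X - r%:P).
  apply/eqP; rewrite -eqp_monic // ?monic_map ?char_poly_monic //.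
  exact: monic_prod_XsubC.
have rs0 : {in rs, forall r, r = 0}.
  move=> r rrs; have : root (map_poly f (char_poly X)) r.
    by rewrite Dc root_prod_XsubC.
  rewrite map_char_poly -root_mxminpoly mxminpoly_map.
  have : map_poly f (mxminpoly X) %| 'X^k.
    rewrite -(map_polyXn f) dvdp_map mxminpoly_min // rmorphXn /= horner_mx_X.
    exact: Xk.
  rewrite -!dvdp_XsubCl => h1 h2; have := dvdp_trans h2 h1.
  rewrite dvdp_XsubCl rootE hornerXn expf_eq0 => /andP[_ /eqP //].
have szrs : size rs = n.+1.
  apply: succn_inj; rewrite -(size_prod_XsubC rs id) -Dc size_map_poly.
  by rewrite size_char_poly.
have := char_poly_trace X isT; rewrite /= => /(congr1 f).
rewrite -coef_map Dc big_seq (eq_bigr (fun=> 'X)); last first.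
  by move=> r /rs0 ->; rewrite subr0.
rewrite -big_seq big_const_seq count_predT szrs iter_mulr_1 coefXn.
rewrite -[n == _]/(n == n.+1) ltn_eqF // => /esym /eqP.
by rewrite fmorph_eq0 oppr_eq0 => /eqP.
Qed.

(** Fitting's decomposition: [E] projects onto the part where [X] is invertible and is a polynomial
    in [X] without constant term. Its trace is therefore 0, but it also equals the rank. *)
Lemma nilp_of_mxtrace (F : fieldType) n (X : 'M[F]_n.+1) : [pchar F] =i pred0 ->
  (forall k, \tr (X ^+ k.+1) = 0) -> exists k, X ^+ k = 0.
Proof.
move=> hF trX; have c0 : char_poly X != 0 by rewrite monic_neq0 ?char_poly_monic.
have [m [r [Dc r0]]] : exists m r, char_poly X = r * 'X^m /\ ~~ root r 0.
  have [m [r /implyP r0 Dc]] := multiplicity_XsubC (char_poly X) 0.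
  by exists m, r; rewrite Dc subr0 r0.
(* The exponent [m.+1] leaves [E] without constant term even for [m = 0]. *)
have /Bezout_eq1_coprimepP[[u v] /= Euv] : coprimep 'X^(m.+1) r.
  by rewrite coprimep_sym coprimep_expr // coprimepX.
pose E := horner_mx X (u * 'X^(m.+1)).
have vr : horner_mx X (v * r) = 1 - E.
  by rewrite -[v * r](addKr (u * 'X^(m.+1))) Euv addrC rmorphB rmorph1.
have EX : X ^+ m.+1 * (1 - E) = 0.
  rewrite -vr -{1}(horner_mx_X X) -rmorphXn -rmorphM /= mulrCA.
  by rewrite exprS -mulrA [_ * r]mulrC -Dc !rmorphM /= Cayley_Hamilton !mulr0.
have EE : E * (1 - E) = 0.
  by rewrite /E {1}rmorphM rmorphXn /= horner_mx_X -mulrA -/E EX mulr0.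
have trE : \tr E = 0.
  rewrite /E [u * _](@mulrC _ u) -[u]coefK poly_def mulr_sumr rmorph_sum raddf_sum big1 //=.
  move=> i _; rewrite -scalerAr linearZ linearZ /= -exprD rmorphXn /= horner_mx_X.
  by rewrite addSn trX mulr0.
have E0 : E = 0.
  move: trE; rewrite mxtrace_idem; last first.
    by apply/eqP; move/eqP: EE; rewrite mulrBr mulr1 subr_eq0 eq_sym.
  case Er: (\rank E) => [|k]; last first.
    by move/eqP; rewrite (negPf (natf_neq0_char0 hF _)).
  by move=> _; apply/eqP; rewrite -mxrank_eq0 Er.
by exists m.+1; move: EX; rewrite E0 subr0 mulr1.
Qed.

(** With [q] a separable radical of the characteristic polynomial and [g] from [newton_lift], [q]
    vanishes at [g(X)] while [X - g(X)] is a multiple of the nilpotent [q(X)]. Having the semisimple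
    part as a polynomial in [X] is what later makes it a left multiplication. *)
Lemma jordan_chevalley (F : fieldType) n (X : 'M[F]_n.+1) : [pchar F] =i pred0 ->
  exists g q, [/\ separable_poly q, horner_mx (horner_mx X g) q = 0 &
    exists k, (X - horner_mx X g) ^+ k = 0].
Proof.
move=> hF; have c0 : char_poly X != 0 by rewrite monic_neq0 ?char_poly_monic.
have [q [k [sepq cq]]] := separable_radical hF c0.
have qX : horner_mx X (q ^+ k) = 0.
  have /dvdpP[r ->] := cq.
  by rewrite rmorphM /= Cayley_Hamilton mulr0.
have [g [qg qkg]] := newton_lift k sepq.
exists g, q; split=> //.
  have -> : horner_mx (horner_mx X g) q = horner_mx X (q \Po g).
    elim/poly_ind: q {sepq cq qX qg qkg} => [|q c IH].
      by rewrite comp_poly0 !rmorph0.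
    rewrite comp_poly_MXaddC !rmorphD !rmorphM /= horner_mx_X !horner_mx_C.
    by rewrite IH.
  have /dvdpP[r ->] := qkg.
  by rewrite exprS mulrCA !rmorphM /= qX !mulr0.
exists k; have /dvdpP[r Er] := qg.
have -> : X - horner_mx X g = horner_mx X (- r * q).
  by rewrite mulNr -Er opprB rmorphB /= horner_mx_X.
by rewrite -rmorphXn exprMn rmorphM /= qX mulr0.
Qed.

(* Once [S, Y] commutes with S, the bracket with Y acts on polynomials in S as
   the derivation with S |-> [S, Y], so [q^`()(S)] kills it, and [q^`()(S)] is
   invertible. *)
Lemma separable_comm (F : fieldType) n (S Y : 'M[F]_n.+1) (q : {poly F}) k :
  separable_poly q -> horner_mx S q = 0 ->
  iter k (fun Z => S * Z - Z * S) Y = 0 -> S * Y = Y * S.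
Proof.
move=> sepq qS; elim: k Y => [|k IH] Y; first by move=> /= ->; rewrite mul0r mulr0.
rewrite iterSr => /IH; set Z := _ - _ => SZ.
have der p : horner_mx S p * Y - Y * horner_mx S p = horner_mx S p^`() * Z.
  elim/poly_ind: p => [|p c Hp].
    by rewrite deriv0 !rmorph0 !mul0r mulr0 subrr.
  rewrite derivD derivC derivM derivX mulr1 addr0 !rmorphD !rmorphM /= !horner_mx_X !horner_mx_C.
  set P := horner_mx S p in Hp *; set P' := horner_mx S p^`() in Hp *.
  have -> : (P' * S + P) * Z = (P * Y - Y * P) * S + P * (S * Y - Y * S).
    by rewrite Hp mulrDl -!mulrA SZ.
  rewrite mulrDl mulrDr [Y * c%:M](scalar_mxC c Y) opprD addrACA subrr addr0.
  by rewrite mulrBl mulrBr !mulrA [RHS]addrC addrA subrK.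
have := der q; rewrite qS mul0r mulr0 subr0 => /esym q'Z.
move: sepq; rewrite unlock => /Bezout_eq1_coprimepP [[u v] /= Euv].
have Z0 : Z = 0.
  rewrite -[Z]mul1r -(rmorph1 (horner_mx S)) -Euv rmorphD !rmorphM /= qS mulr0 add0r.
  by rewrite -mulrA q'Z mulr0.
by apply/eqP; rewrite -subr_eq0 -/Z Z0.
Qed.

End Matrices.

(** Matrix products do not commute, so after expansion each product is abstracted to an opaque
    matrix; the additive identity that remains is checked entrywise by [ring]. *)
Ltac mx_additive :=
  rewrite ?mulmxDr ?mulmxDl ?mulmxBr ?mulmxBl ?mulmxDr ?mulmxDl ?mulmxBr ?mulmxBl;
  rewrite ?mulmxDr ?mulmxDl ?mulmxBr ?mulmxBl ?mulmxN ?mulNmx ?mulmxA;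
  repeat match goal with |- context [?A *m ?B] =>
    let M := fresh "M" in set M := A *m B; clearbody M end;
  apply/matrixP => ? ?; rewrite !mxE; ring.

Definition mxad (F : fieldType) n (M X : 'M[F]_n) : 'M[F]_n := M *m X - X *m M.
Definition mxjp (F : fieldType) n (M X : 'M[F]_n) : 'M[F]_n := M *m X + X *m M.

Section AdBasics.
Variables (F : fieldType) (n : nat).
Implicit Types (M X Y : 'M[F]_n).

Lemma mxadD M : {morph mxad M : X Y / X + Y}.
Proof. by move=> X Y; rewrite /mxad mulmxDr mulmxDl opprD addrACA. Qed.
Lemma mxadZ M a : {morph mxad M : X / a *: X}.
Proof. by move=> X; rewrite /mxad -scalemxAl -scalemxAr scalerBr. Qed.
Lemma mxad0 M : mxad M 0 = 0.
Proof. by rewrite /mxad mulmx0 mul0mx subrr. Qed.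
Lemma mxadB M X Y : mxad M (X - Y) = mxad M X - mxad M Y.
Proof. by rewrite -scaleN1r mxadD mxadZ scaleN1r. Qed.
Lemma mxadDl M N X : mxad (M + N) X = mxad M X + mxad N X.
Proof. by rewrite /mxad mulmxDr mulmxDl opprD addrACA. Qed.
Lemma mxadC M X : mxad M X = - mxad X M.
Proof. by rewrite /mxad opprB. Qed.
Lemma mxad_jacobi M X Y : mxad (mxad M X) Y = mxad M (mxad X Y) - mxad X (mxad M Y).
Proof.
by rewrite /mxad; mx_additive.
Qed.

End AdBasics.

(** * Nilpotency of brackets with a left multiplication *)

Section SymmetrizedRelations.
Variables (F : fieldType) (n : nat).
Hypothesis charF : [pchar F] =i pred0.
Variables (M : 'M[F]_n.+1) (v : 'cV[F]_n.+1).
Variables inV inL : 'M[F]_n.+1 -> Prop.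
Local Notation sg := (mxjp M).
Local Notation dl := (mxad M).
Hypothesis VL : forall X, inV X -> inL X.
Hypothesis LD : forall X Y, inL X -> inL Y -> inL (X + Y).
Hypothesis LZ : forall a X, inL X -> inL (a *: X).
Hypothesis Ljp : forall X, inL X -> inL (sg X).
Hypothesis Linj : forall X, inL X -> X *m v = 0 -> X = 0.
Hypothesis Vad2 : forall X, inV X -> inV (dl (dl X)).
Hypothesis Vad : forall X, inV X -> dl X *m v = 0.

(** Combinations of degree below [m] in [sg]. The matrix [X] varies from term to term because
    lowering the degree of an iterate replaces [X] by [dl (dl X)]. In the application [M] is [L a],
    [inV] is [L V], [inL] is [L A] and [v] represents the unit. *)
Inductive jp_comb m : 'M[F]_n.+1 -> Prop :=
| jp_comb0 : jp_comb m 0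
| jp_combS k c X T : (k < m)%N -> inV X -> jp_comb m T ->
    jp_comb m (c *: iter k sg X + T).

Lemma jp_combD m T U : jp_comb m T -> jp_comb m U -> jp_comb m (T + U).
Proof. by move=> hT hU; elim: hT => [|*]; rewrite ?add0r // -addrA; apply: jp_combS. Qed.

Lemma jp_combZ m a T : jp_comb m T -> jp_comb m (a *: T).
Proof.
elim=> [|k c X U km VX _ IH]; first by rewrite scaler0; apply: jp_comb0.
by rewrite scalerDr scalerA; apply: jp_combS.
Qed.

Lemma jp_comb_iter m k X : (k < m)%N -> inV X -> jp_comb m (iter k sg X).
Proof.
by move=> km VX; rewrite -[iter _ _ _]scale1r -[_ *: _]addr0; apply: jp_combS => //; apply: jp_comb0.
Qed.

Lemma jp_combW m m' T : (m <= m')%N -> jp_comb m T -> jp_comb m' T.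
Proof.
move=> mm'; elim=> [|k c X U km VX _ IH]; first exact: jp_comb0.
by apply: jp_combS => //; apply: leq_trans mm'.
Qed.

Lemma jp_comb_inL m T : jp_comb m T -> T = 0 \/ inL T.
Proof.
elim=> [|k c X U km VX _ [->|IH]]; [by left| |]; right; rewrite ?addr0.
  by apply: LZ; elim: k {km} => [|k IH]; [apply: VL | apply: Ljp].
by apply: LD => //; apply: LZ; elim: k {km} => [|k IHk]; [apply: VL | apply: Ljp].
Qed.

Lemma mxad_jpC X : dl (sg X) = sg (dl X).
Proof.
by rewrite /mxad /mxjp; mx_additive.
Qed.

Lemma mxad_iter_jpC k X : dl (iter k sg X) = iter k sg (dl X).
Proof. by elim: k => //= k IH; rewrite mxad_jpC IH. Qed.

Lemma mxjp_ad_apply X : sg X *m v = (M *m (X *m v)) *+ 2 - dl X *m v.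
Proof.
by rewrite /mxjp /mxad; mx_additive.
Qed.

(** By [mxjp_ad_apply], at [v] the operator [2 M] differs from [sg] by a bracket with [M], which the
    hypothesis keeps in lower degree; so [2 M] raises the degree by one only. *)
Lemma mulmx_jp_comb k T :
  (forall j X, (j < k)%N -> inV X ->
     exists2 U, jp_comb j U & dl (iter j sg X) *m v = U *m v) ->
  jp_comb k T ->
  exists2 U, jp_comb k.+1 U & (M *m (T *m v)) *+ 2 = U *m v.
Proof.
move=> weak; elim=> [|j c X T' jk VX _ [U hU EU]].
  by exists 0; [exact: jp_comb0 | rewrite !mul0mx mulmx0 mul0rn].
have [W hW EW] := weak j X jk VX.
exists (c *: (iter j.+1 sg X + W) + U).
  apply: jp_combD => //; apply: jp_combZ; apply: jp_combD.
    exact: jp_comb_iter.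
  by apply: jp_combW hW; apply: leqW; apply: ltnW.
rewrite mulmxDl mulmxDr mulrnDl EU mulmxDl -!scalemxAl mulmxDl -EW.
by rewrite iterS mxjp_ad_apply subrK -scalemxAr scalerMnr.
Qed.

(* On the vectors [iter k sg X *m v], bracketing with [M] lowers the degree [k] by one,
   with leading coefficient [- k]. *)
Lemma mxad_iter_jp k X : inV X -> exists2 T, jp_comb k T &
  dl (iter k.+1 sg X) *m v = - k.+1%:R *: (iter k sg (dl (dl X)) *m v) + T *m v.
Proof.
have [m] := ubnP k; elim: m k X => // m IH k X km VX.
have weak j Y : (j < k.+1)%N -> inV Y ->
    exists2 U, jp_comb j U & dl (iter j sg Y) *m v = U *m v.
  case: j => [|j] jk VY; first by exists 0; [exact: jp_comb0 | rewrite mul0mx Vad].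
  have [|T hT ET] := IH j Y _ VY; first exact: leq_trans jk km.
  exists (- j.+1%:R *: iter j sg (dl (dl Y)) + T); last first.
    by rewrite ET mulmxDl scalemxAl.
  apply: jp_combS => //; [exact: Vad2 | exact: jp_combW hT].
have VX2 := Vad2 VX.
(* The leading coefficient drops by one at each stage: [2 M] carries the previous leading term one
   degree up, and the second bracket contributes a further [-1]. *)
rewrite mxad_iter_jpC iterS mxjp_ad_apply -!mxad_iter_jpC.
case: k km weak => [|k] km weak.
  exists 0; first exact: jp_comb0.
  by rewrite /= Vad // mulmx0 mul0rn add0r mul0mx addr0 scaleN1r.
have [|T hT ->] := IH k X _ VX; first exact: km.
have [j Y jk VY|U hU EU] := @mulmx_jp_comb k T _ hT; first by apply: weak => //; rewrite ltnS leqW // ltnW.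
have [W hW EW] := weak k _ (leqW (leqnn _)) VX2.
exists (- k.+1%:R *: W + U).
  by apply: jp_combD => //; apply: jp_combZ; apply: jp_combW hW.
rewrite mulmxDr mulrnDl EU [in RHS](mulmxDl (- _ *: W)) -scalemxAl -EW -scalemxAr scalerMnr.
have -> : M *m (iter k sg (dl (dl X)) *m v) *+ 2 =
   iter k.+1 sg (dl (dl X)) *m v + dl (iter k sg (dl (dl X))) *m v.
  by rewrite [iter _.+1 _ _]iterS mxjp_ad_apply subrK.
rewrite -!mxad_iter_jpC -[k.+2]addn1 natrD.
move: (dl (dl (iter k.+1 _ _)) *m v) (dl (dl (dl (iter k _ _))) *m v) (U *m v) => a b u.
by apply/matrixP => i j; rewrite !mxE; ring.
Qed.

(** Each round turns a monic relation for [X] into one for [dl (dl X)] of degree one less, made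
    monic again by dividing by [- d.+1%:R]; this is where characteristic 0 enters. In degree 0
    [Linj] concludes. *)
Lemma mxad_jp_relation d X T : inV X -> jp_comb d T ->
  (iter d sg X + T) *m v = 0 -> iter d (dl \o dl) X = 0.
Proof.
elim: d X T => [|d IH] X T VX hT.
  case: hT => [|k c Y U //]; rewrite addr0 /= => Xv.
  exact: Linj (VL VX) Xv.
move=> E0; have /(congr1 (fun W => dl W *m v)) : iter d.+1 sg X + T = 0.
  apply: Linj E0; have [->|LT] := jp_comb_inL hT.
    by rewrite addr0; elim: (d.+1) => [|k IHk]; [apply: VL | apply: Ljp].
  by apply: LD => //; elim: (d.+1) => [|k IHk]; [apply: VL | apply: Ljp].
rewrite mxadD mulmxDl mxad0 mul0mx.
have [T1 hT1 ->] := mxad_iter_jp d VX.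
have [T2 hT2 ->] : exists2 U, jp_comb d U & dl T *m v = U *m v.
  elim: hT => [|k c Y U kd VY _ [W hW EW]].
    by exists 0; [exact: jp_comb0 | rewrite mxad0].
  rewrite mxadD mxadZ mulmxDl EW -scalemxAl.
  case: k kd => [|k] kd; first by exists W => //; rewrite Vad // scaler0 add0r.
  have [T3 hT3 ->] := mxad_iter_jp k VY.
  exists (c *: (- k.+1%:R *: iter k sg (dl (dl Y)) + T3) + W).
    apply: jp_combD => //; apply/jp_combZ/jp_combD; last exact: jp_combW (ltnW (kd : (k < d)%N)) hT3.
    by apply/jp_combZ/jp_comb_iter => //; exact: Vad2.
  by rewrite mulmxDl -scalemxAl mulmxDl scalemxAl.
rewrite -addrA -mulmxDl => E1; rewrite iterSr.
have d0 := natf_neq0_char0 charF d.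
apply: (IH _ (- d.+1%:R^-1 *: (T1 + T2))); [exact: Vad2| exact/jp_combZ/jp_combD|].
rewrite mulmxDl -scalemxAl; apply: (scalerI (_ : - d.+1%:R != 0)); rewrite ?oppr_eq0 //.
by rewrite scaler0 scalerDr scalerA mulrNN divff // scale1r.
Qed.

(* The n+2 vectors [iter j sg X *m v] are linearly dependent. *)
Lemma mxad_nilpotent X : inV X -> exists k, iter k dl X = 0.
Proof.
move=> VX; pose B := \matrix_(j < n.+2) (iter j sg X *m v)^T.
have : kermx B != 0.
  rewrite -mxrank_eq0 mxrank_ker subn_eq0 -ltnNge ltnS; exact: rank_leq_col.
case/rowV0Pn => c /sub_kermxP cB c0.
(* The dependency is cut after its last nonzero coefficient, so that it can be made monic. *)
have [m [a [am E]]] : exists m (a : nat -> F),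
    a m != 0 /\ \sum_(j < m.+1) a j *: (iter j sg X *m v) = 0.
  have [i ci] := rV0Pn _ c0.
  pose a j := if insub j is Some k then c 0 k else 0 : F.
  have Ea : \sum_(j < n.+2) a j *: (iter j sg X *m v) = 0.
    apply: trmx_inj; rewrite trmx0 -cB mulmx_sum_row linear_sum; apply: eq_bigr => j _.
    by rewrite /a valK /= linearZ rowK.
  have [j [aj jn]] : exists j, a j != 0 /\ (j < n.+2)%N.
    by exists i; rewrite /a valK; split.
  elim: (n.+2) jn Ea => // m IH jm Ea.
  have [am|am] := eqVneq (a m) 0; last by exists m, a.
  apply: IH; last by move: Ea; rewrite big_ord_recr /= am scale0r addr0.
  by rewrite ltn_neqAle -ltnS jm andbT; apply: contraNneq aj => ->; rewrite am.
exists (m + m)%N.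
have -> : iter (m + m) dl X = iter m (dl \o dl) X.
  by elim: m {am E} => //= m IH; rewrite addnS /= IH.
apply: (@mxad_jp_relation m X (\sum_(j < m) ((a m)^-1 * a j) *: iter j sg X)) => //.
  rewrite -(big_mkord xpredT (fun j => ((a m)^-1 * a j) *: iter j sg X)).
  rewrite big_seq; elim/big_ind: _ => [||j]; [exact: jp_comb0 | exact: jp_combD |].
  by rewrite mem_index_iota => /andP[_ jm]; apply/jp_combZ/jp_comb_iter.
apply: (scalerI am); rewrite scaler0 -E big_ord_recr /= mulmxDl scalerDr addrC.
congr (_ + _); rewrite mulmx_suml scaler_sumr; apply: eq_bigr => j _.
by rewrite -scalemxAl scalerA mulrA divff // mul1r.
Qed.

End SymmetrizedRelations.

(** * Cartan's criterion for triple systems *)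

Section PolyAction.
Variables (K : fieldType) (V : lmodType K) (f : {linear V -> V}).

(** Evaluation of [p] at the endomorphism [f]. It serves for [f = mxad D], an operator on matrices,
    without choosing a matrix for that operator. *)
Definition poly_act (p : {poly K}) (x : V) : V :=
  \sum_(i < size p) p`_i *: iter i f x.

Lemma poly_actE m (p : {poly K}) x : (size p <= m)%N ->
  poly_act p x = \sum_(i < m) p`_i *: iter i f x.
Proof.
move=> pm; rewrite /poly_act (big_ord_widen _ (fun i => p`_i *: iter i f x) pm).
rewrite big_mkcond /=; apply: eq_bigr => i _.
by case: ltnP => // /(nth_default 0) ->; rewrite scale0r.
Qed.

Lemma poly_actDl (p q : {poly K}) x : poly_act (p + q) x = poly_act p x + poly_act q x.
Proof.
rewrite (@poly_actE (maxn (size p) (size q)) (p + q) x) ?size_polyD //.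
rewrite (poly_actE _ (leq_maxl (size p) (size q))).
rewrite (poly_actE _ (leq_maxr (size p) (size q))) -big_split /=.
by apply: eq_bigr => i _; rewrite coefD scalerDl.
Qed.

Lemma poly_actC c x : poly_act c%:P x = c *: x.
Proof.
by rewrite (poly_actE _ (size_polyC_leq1 c)) big_ord_recl big_ord0 /= coefC addr0.
Qed.

Lemma poly_actMX (p : {poly K}) x : poly_act (p * 'X) x = poly_act p (f x).
Proof.
have h : (size (p * 'X)%R <= (size p).+1)%N.
  by apply: leq_trans (size_polyMleq _ _) _; rewrite size_polyX addn2.
rewrite (poly_actE _ h) big_ord_recl coefMX /= scale0r add0r.
by apply: eq_bigr => i _; rewrite coefMX /= -iterS iterSr.
Qed.

Lemma poly_act_linear p : linear (poly_act p).
Proof.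
move=> a x y; rewrite /poly_act scaler_sumr -big_split /=; apply: eq_bigr => i _.
rewrite scalerA [a * _]mulrC -scalerA -scalerDr; congr (_ *: _).
by elim: (i : nat) => //= k ->; rewrite linearP.
Qed.

Lemma poly_actDr p x y : poly_act p (x + y) = poly_act p x + poly_act p y.
Proof. by rewrite -[x]scale1r poly_act_linear !scale1r. Qed.

Lemma poly_act0 p : poly_act p 0 = 0.
Proof. by apply: (addrI (poly_act p 0)); rewrite -poly_actDr !addr0. Qed.

Lemma poly_act_sum (I : Type) (r : seq I) p (F : I -> V) :
  poly_act p (\sum_(i <- r) F i) = \sum_(i <- r) poly_act p (F i).
Proof. by elim/big_rec2: _ => [|i y x _ <-]; rewrite ?poly_act0 // poly_actDr. Qed.

Lemma poly_actZl c (p : {poly K}) x : poly_act (c *: p) x = c *: poly_act p x.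
Proof.
rewrite (poly_actE _ (size_scale_leq c p)) /poly_act scaler_sumr.
by apply: eq_bigr => i _; rewrite coefZ scalerA.
Qed.

Lemma poly_act_comm p x : poly_act p (f x) = f (poly_act p x).
Proof.
rewrite /poly_act raddf_sum; apply: eq_bigr => i _.
by rewrite [RHS]linearZ -iterS iterSr.
Qed.

Lemma poly_actM (p q : {poly K}) x : poly_act (p * q) x = poly_act p (poly_act q x).
Proof.
elim/poly_ind: p q x => [|p c IH] q x.
  by rewrite mul0r /poly_act size_poly0 !big_ord0.
rewrite mulrDl !poly_actDl poly_actC mul_polyC poly_actZl; congr (_ + _).
by rewrite -mulrA ['X * q]mulrC IH !poly_actMX (poly_act_comm q).
Qed.
End PolyAction.

(** Turns a function [c] on the weights into a polynomial in [mxad D]; the order [m] absorbs the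
    nilpotent part of [mxad D] on each weight space. *)
Lemma poly_crt (K : fieldType) (gs : seq K) (c : K -> K) m : uniq gs ->
  exists P : {poly K}, {in gs, forall g, ('X - g%:P) ^+ m %| P - (c g)%:P}.
Proof.
elim: gs => [|g gs IH] /=; first by exists 0.
case/andP=> ggs /IH[P0 hP0]; pose A := (\prod_(h <- gs) ('X - h%:P)) ^+ m.
have : coprimep A (('X - g%:P) ^+ m).
  by rewrite coprimep_expl // coprimep_expr // coprimep_XsubC root_prod_XsubC.
case/Bezout_eq1_coprimepP => -[u v] /= Euv.
exists (P0 + ((c g)%:P - P0) * (u * A)) => h; rewrite inE => /predU1P[->|hgs].
  have -> : P0 + ((c g)%:P - P0) * (u * A) - (c g)%:P =
            ((P0 - (c g)%:P) * v) * ('X - g%:P) ^+ m.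
    by rewrite -[u * A](addrK (v * ('X - g%:P) ^+ m)) Euv; ring.
  exact: dvdp_mull.
rewrite addrAC; apply: dvdp_add; first exact: hP0.
apply/dvdp_mull/dvdp_mull; rewrite /A (perm_big _ (perm_to_rem hgs)) big_cons exprMn.
exact: dvdp_mulr.
Qed.

Fact mxad_is_linear (F : fieldType) n (M : 'M[F]_n) : linear (mxad M).
Proof. by move=> a X Y; rewrite mxadD mxadZ. Qed.
HB.instance Definition _ (F : fieldType) n (M : 'M[F]_n) :=
  GRing.isLinear.Build F 'M[F]_n 'M[F]_n _ (mxad M) (mxad_is_linear M).

(** After [k + k] brackets every term has at least [k] factors [N] on one side of [Z]. *)
Lemma mxad_nilp (F : fieldType) n (N Z : 'M[F]_n.+1) k : N ^+ k = 0 ->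
  iter (k + k) (mxad N) Z = 0.
Proof.
move=> Nk; have N0 j : (k <= j)%N -> N ^+ j = 0.
  by move=> kj; rewrite -(subnKC kj) exprD Nk mul0r.
suff h m a b : (k + k <= a + b + m)%N -> iter m (mxad N) (N ^+ a * Z * N ^+ b) = 0.
  by have := h (k + k)%N 0%N 0%N (leqnn _); rewrite !expr0 mul1r mulr1.
elim: m a b => [|m IH] a b h.
  have [ka|ak] := leqP k a; first by rewrite /= N0 // !mul0r.
  rewrite /= (N0 b) ?mulr0 //; rewrite addn0 in h.
  by rewrite -(leq_add2l k) (leq_trans h) // leq_add2r ltnW.
rewrite iterSr; have -> : mxad N (N ^+ a * Z * N ^+ b) =
    N ^+ a.+1 * Z * N ^+ b - N ^+ a * Z * N ^+ b.+1.
  by rewrite /mxad !mulmxE exprS exprSr !mulrA.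
have iterB X Y : iter m (mxad N) (X - Y) = iter m (mxad N) X - iter m (mxad N) Y.
  by elim: m {IH h} => //= m ->; rewrite raddfB.
by rewrite iterB (IH a.+1) ?(IH a b.+1) ?subrr ?addnS ?addSn -?addnS.
Qed.

(** * Replicas of a diagonal matrix and rational relations *)

Section RationalReplica.
Variables (K : fieldType) (charK : [pchar K] =i pred0).

Let ratrK : rat -> K := @ratr K.

Let nz_int (z : int) : z != 0 -> z%:~R != 0 :> K.
Proof.
by case: z => [[|m]|m] // _; rewrite ?NegzE ?mulrNz ?oppr_eq0 (natf_neq0_char0 charK).
Qed.

Fact ratrK_zmod : zmod_morphism ratrK.
Proof.
have injZtoQ: @injective rat int intr by apply: intr_inj.
have nz_den x : (denq x)%:~R != 0 :> K by rewrite nz_int ?denq_eq0.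
move=> x y; rewrite /ratrK /ratr.
apply: (canLR (mulfK (nz_den _))); apply: (mulIf (nz_den x)).
rewrite mulrAC mulrBl divfK ?nz_den // mulrAC -!rmorphM.
apply: (mulIf (nz_den y)); rewrite mulrAC mulrBl divfK ?nz_den //.
rewrite -!(rmorphM, rmorphB); congr _%:~R; apply: injZtoQ.
rewrite !(rmorphM, rmorphB) /= [_ - _]lock /= -lock !numqE.
ring.
Qed.

Fact ratrK_monoid : monoid_morphism ratrK.
Proof.
have injZtoQ: @injective rat int intr by apply: intr_inj.
have nz_den x : (denq x)%:~R != 0 :> K by rewrite nz_int ?denq_eq0.
split=> [|x y]; first by rewrite /ratrK /ratr divr1.
rewrite /ratrK /ratr; apply: (mulIf (nz_den (x * y))); rewrite divfK //.
apply: (mulIf (nz_den x)); apply: (mulIf (nz_den y)).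
rewrite [RHS](_ : _ = (numq x)%:~R * (numq y)%:~R * (denq (x * y))%:~R); last first.
  by field; rewrite !nz_den.
rewrite -!rmorphM; congr _%:~R; apply: injZtoQ; rewrite !rmorphM /= !numqE.
ring.
Qed.

HB.instance Definition _ := GRing.isZmodMorphism.Build rat K ratrK ratrK_zmod.
HB.instance Definition _ := GRing.isMonoidMorphism.Build rat K ratrK ratrK_monoid.

Variables (n : nat) (d : 'rV[K]_n).

Let quad := ('I_n * 'I_n * ('I_n * 'I_n))%type.
Let rel_quad (q : quad) := d 0 q.1.1 - d 0 q.1.2 == d 0 q.2.1 - d 0 q.2.2.
(** The left kernel of [B] consists of the [r] whose differences satisfy the same equalities as
    those of [d]. Its entries are integers, so it is available over [rat] and over [K] alike. *)
Let B (R : fieldType) : 'M[R]_(n, #|{: quad}|) := \matrix_(i, q)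
  (let q := enum_val q in if rel_quad q then
    (i == q.1.1)%:R - (i == q.1.2)%:R - ((i == q.2.1)%:R - (i == q.2.2)%:R) else 0).

Let mulB (R : fieldType) (r : 'rV[R]_n) q : (r *m B R) 0 q =
  (let q := enum_val q in if rel_quad q then
    r 0 q.1.1 - r 0 q.1.2 - (r 0 q.2.1 - r 0 q.2.2) else 0).
Proof.
rewrite mxE; cbv zeta; case: ifP => rq; last first.
  by apply: big1 => i _; rewrite mxE; cbv zeta; rewrite rq mulr0.
have pick (j : 'I_n) : \sum_i r 0 i * (i == j)%:R = r 0 j.
  rewrite (bigD1 j) //= eqxx mulr1 big1 ?addr0 // => i /negPf ->.
  by rewrite mulr0.
rewrite -!pick -!sumrB; apply: eq_bigr => i _.
by rewrite mxE; cbv zeta; rewrite rq !mulrBr.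
Qed.

(* The relations satisfied by the entries of d have rational coefficients, and
   the standard form is anisotropic over [rat]; so d, being a solution orthogonal
   to all solutions, is zero. *)
Lemma rational_replica :
  (forall r : 'rV[K]_n,
     (forall i j k l, d 0 i - d 0 j = d 0 k - d 0 l -> r 0 i - r 0 j = r 0 k - r 0 l) ->
     \sum_i d 0 i * r 0 i = 0) -> d = 0.
Proof.
(* A row killed by [G] lies in the left kernel of [B] and is orthogonal to it. Over [rat] its sum of
   squares is 0, so [G] is row free, and this persists over [K]. *)
move=> orth; pose G := row_mx (B rat) (kermx (B rat))^T.
have fG : row_free G.
  rewrite -kermx_eq0; apply/eqP/row_matrixP => i; rewrite row0.
  set w := row i _; have : w *m G = 0 by apply/sub_kermxP; exact: row_sub.
  rewrite mul_mx_row -row_mx0 => /eq_row_mx[wB wk].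
  have /submxP[u Eu] : (w <= kermx (B rat))%MS by apply/sub_kermxP.
  have : (w *m w^T) 0 0 = 0 by rewrite {2}Eu trmx_mul mulmxA wk mul0mx mxE.
  rewrite mxE => /eqP; rewrite psumr_eq0; last by move=> j _; rewrite [w^T _ _]mxE; exact: sqr_ge0.
  move=> /allP w0; apply/rowP => j; rewrite [RHS]mxE.
  have := w0 j (mem_index_enum _); rewrite /= [w^T _ _]mxE mulf_eq0 orbb.
  by move/eqP.
have BK : map_mx ratrK (B rat) = B K.
  apply/matrixP => i q; rewrite !mxE /=; case: ifP => _; last exact: rmorph0.
  by rewrite !rmorphB /= !rmorph_nat.
have dB : d *m B K = 0.
  apply/rowP => q; rewrite mulB /= mxE; case: ifP => // /eqP ->.
  by rewrite subrr.
have dk : d *m (kermx (B K))^T = 0.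
  apply/rowP => i; rewrite !mxE.
  rewrite (eq_bigr (fun j => d 0 j * row i (kermx (B K)) 0 j)); last first.
    by move=> j _; rewrite !mxE.
  apply: orth => i1 i2 i3 i4 /eqP dq.
  have : (row i (kermx (B K)) *m B K) 0 (enum_rank ((i1, i2), (i3, i4))) = 0.
    by rewrite -row_mul mulmx_ker row0 mxE.
  by rewrite mulB /= enum_rankK /rel_quad /= dq => /eqP; rewrite subr_eq0 => /eqP.
have : row_free (map_mx ratrK G) by rewrite row_free_map.
rewrite -kermx_eq0 => /eqP kG; have : (d <= kermx (map_mx ratrK G))%MS.
  apply/sub_kermxP; rewrite map_row_mx -matrix.map_trmx map_kermx BK mul_mx_row dB dk.
  exact: row_mx0.
by rewrite kG submx0 => /eqP.
Qed.
End RationalReplica.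

Inductive bracket_span (F : fieldType) n (T : 'M[F]_n -> Prop) : 'M[F]_n -> Prop :=
| bracket_span0 : bracket_span T 0
| bracket_spanS X Y D : T X -> T Y -> bracket_span T D ->
    bracket_span T (mxad X Y + D).

(** * Cartan's criterion when the semisimple part is diagonal *)

Section CartanDiag.
Variables (K : fieldType) (n : nat) (charK : [pchar K] =i pred0).
Variables (T : 'M[K]_n.+1 -> Prop) (d : 'rV[K]_n.+1) (N : 'M[K]_n.+1) (k : nat).
Hypothesis dN : diag_mx d *m N = N *m diag_mx d.
Hypothesis Nk : N ^+ k = 0.
Let D := diag_mx d + N.
Hypothesis trT : forall X Y, T X -> T Y -> \tr (X *m Y) = 0.
Hypothesis adT : forall X, T X -> T (mxad D X).
Hypothesis spanD : bracket_span T D.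

(** Component of [Y] in the eigenspace of [mxad (diag_mx d)] for the eigenvalue [g]. *)
Definition weight_part (g : K) (Y : 'M[K]_n.+1) : 'M[K]_n.+1 :=
  \matrix_(i, j) if d 0 i - d 0 j == g then Y i j else 0.

Lemma mxad_diagE (r : 'rV[K]_n.+1) Y i j :
  mxad (diag_mx r) Y i j = (r 0 i - r 0 j) * Y i j.
Proof. by rewrite /mxad mul_diag_mx mul_mx_diag !mxE mulrBl [r 0 j * _]mulrC. Qed.

Lemma diag_comm_entry i j : d 0 i != d 0 j -> N i j = 0.
Proof.
move=> dij; have := mxad_diagE d N i j; rewrite /mxad dN subrr mxE => /esym/eqP.
by rewrite mulf_eq0 subr_eq0 (negPf dij) => /eqP.
Qed.

Lemma weight_part_adN g Y :
  weight_part g Y = Y -> weight_part g (mxad N Y) = mxad N Y.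
Proof.
move=> EY; apply/matrixP => i j; rewrite mxE; case: eqP => // dij.
have Y0 a b : d 0 a - d 0 b <> g -> Y a b = 0.
  by move=> dab; rewrite -EY mxE; case: eqP.
rewrite /mxad !mxE !big1 ?subrr // => l _.
  have [dl|dl] := eqVneq (d 0 l) (d 0 j); last by rewrite (diag_comm_entry dl) mulr0.
  by rewrite Y0 ?mul0r // dl.
have [dl|dl] := eqVneq (d 0 i) (d 0 l); last by rewrite (diag_comm_entry dl) mul0r.
by rewrite Y0 ?mulr0 // -dl.
Qed.

(** On this eigenspace [mxad (diag_mx d)] is the scalar [g], and [mxad N] preserves it since [N]
    commutes with [diag_mx d]. *)
Lemma weight_part_act g Y m : weight_part g Y = Y ->
  poly_act (mxad D) (('X - g%:P) ^+ m) Y = iter m (mxad N) Y.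
Proof.
elim: m Y => [|m IH] Y EY; first by rewrite expr0 poly_actC scale1r.
rewrite exprSr poly_actM iterSr -IH; last exact: weight_part_adN.
congr poly_act; rewrite poly_actDl -{1}['X]mul1r poly_actMX -polyCN !poly_actC.
rewrite scale1r /= /D mxadDl; suff -> : mxad (diag_mx d) Y = g *: Y.
  by rewrite scaleNr addrAC subrr add0r.
apply/matrixP => i j; rewrite mxad_diagE -EY !mxE.
by case: eqP => [->|]; rewrite ?mulr0.
Qed.

Lemma weight_partK g Y : weight_part g (weight_part g Y) = weight_part g Y.
Proof. by apply/matrixP => i j; rewrite /weight_part !mxE; case: eqP. Qed.

(** The hypothesis makes [r 0 i - r 0 j] a function [c] of the weight [d 0 i - d 0 j]. Interpolating
    [c] to order [k + k], beyond which [mxad N] vanishes, gives a polynomial that acts on each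
    weight space as the scalar [c g]. *)
Lemma mxad_replica (r : 'rV[K]_n.+1) :
  (forall i j k l, d 0 i - d 0 j = d 0 k - d 0 l -> r 0 i - r 0 j = r 0 k - r 0 l) ->
  exists p, forall Y, mxad (diag_mx r) Y = poly_act (mxad D) p Y.
Proof.
move=> rel; pose gs := undup [seq d 0 ij.1 - d 0 ij.2 | ij : 'I_n.+1 * 'I_n.+1].
have gsP i j : d 0 i - d 0 j \in gs.
  by rewrite mem_undup; apply/imageP; exists (i, j).
have [c hc] : exists c : K -> K, forall i j, c (d 0 i - d 0 j) = r 0 i - r 0 j.
  exists (fun g => if [pick ij : 'I_n.+1 * 'I_n.+1 | d 0 ij.1 - d 0 ij.2 == g] is Some ij
                   then r 0 ij.1 - r 0 ij.2 else 0) => i j.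
  case: pickP => [[a b] /= /eqP /rel //|/(_ (i, j))]; by rewrite eqxx.
have [p hp] := poly_crt c (k + k) (undup_uniq [seq d 0 ij.1 - d 0 ij.2 | ij : 'I_n.+1 * 'I_n.+1]).
exists p => Y.
have EY : Y = \sum_(g <- gs) weight_part g Y.
  apply/matrixP => i j; rewrite summxE (bigD1_seq (d 0 i - d 0 j)) ?undup_uniq //=.
  rewrite mxE eqxx big1 ?addr0 // => g /negPf gij.
  by rewrite mxE eq_sym gij.
rewrite {2}EY poly_act_sum (eq_big_seq (fun g => c g *: weight_part g Y)); last first.
  move=> g /hp /dvdpP[q Eq].
  rewrite -[p](subrK (c g)%:P) Eq poly_actDl poly_actM poly_actC.
  by rewrite weight_part_act ?weight_partK // mxad_nilp // poly_act0 add0r.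
apply/matrixP => i j; rewrite mxad_diagE summxE (bigD1_seq (d 0 i - d 0 j)) ?undup_uniq //=.
rewrite !mxE eqxx hc big1 ?addr0 // => g /negPf gij.
by rewrite !mxE eq_sym gij mulr0.
Qed.

(** Invariance of the trace moves the replica onto one factor of each bracket in [D], where it is a
    combination of iterated brackets with [D], which stay in [T]; so [D] is orthogonal to every
    replica. So is [N], being nilpotent and commuting with replicas, and [rational_replica] applies
    to what is left. *)
Lemma cartan_diag : d = 0.
Proof.
apply: (rational_replica charK) => r rel; have [p hp] := mxad_replica rel.
have iterT m Y : T Y -> T (iter m (mxad D) Y).
  by move=> TY; elim: m => //= m; apply: adT.
have trp X Y : T X -> T Y -> \tr (X *m mxad (diag_mx r) Y) = 0.
  move=> TX TY; rewrite hp /poly_act mulmx_sumr raddf_sum big1 // => i _.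
  by rewrite /= -scalemxAr mxtraceZ trT ?mulr0 //; apply: iterT.
have trD : \tr (D *m diag_mx r) = 0.
  elim: spanD => [|X Y E TX TY _ IH]; first by rewrite mul0mx mxtrace0.
  rewrite mulmxDl mxtraceD IH addr0.
  have -> : \tr (mxad X Y *m diag_mx r) = - \tr (X *m mxad (diag_mx r) Y).
    rewrite -raddfN -mulmxN -mxadC /mxad mulmxBl mulmxBr !raddfB /=.
    by rewrite !mulmxA -[Y *m X *m _]mulmxA [\tr (Y *m _)]mxtrace_mulC.
  by rewrite trp ?oppr0.
have NC : N *m diag_mx r = diag_mx r *m N.
  apply/matrixP => i j; rewrite mul_diag_mx mul_mx_diag !mxE.
  have [dij|dij] := eqVneq (d 0 i) (d 0 j); last by rewrite (diag_comm_entry dij) mulr0 mul0r.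
  rewrite mulrC; congr (_ * _); apply/eqP; rewrite -subr_eq0; apply/eqP.
  by rewrite -(subrr (r 0 i)); apply: rel; rewrite dij !subrr.
have trN : \tr (N *m diag_mx r) = 0.
  apply: (@mxtrace_nilp _ _ _ k).
  have cN : GRing.comm N (diag_mx r) by exact: NC.
  by rewrite -[_ *m _]/(N * diag_mx r) exprMn_comm // Nk mul0r.
move: trD; rewrite /D mulmxDl mxtraceD trN addr0 mulmx_diag mxtrace_diag => E; rewrite -[RHS]E.
by apply: eq_bigr => i _; rewrite mxE.
Qed.

End CartanDiag.

(** * Nilpotency of sums of brackets over the ground field *)

Section CartanNilpotent.
Variables (F : fieldType) (n : nat) (charF : [pchar F] =i pred0).
Variables (T : 'M[F]_n.+1 -> Prop).
Hypothesis T0 : T 0.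
Hypothesis TD : forall X Y, T X -> T Y -> T (X + Y).
Hypothesis Tnil : forall X, T X -> exists k, X ^+ k = 0.
Hypothesis Ttrip : forall X Y Z, T X -> T Y -> T Z -> T (mxad (mxad X Y) Z).

(** Polarisation of the vanishing of the trace of a nilpotent square. *)
Lemma lts_trace_form X Y : T X -> T Y -> \tr (X *m Y) = 0.
Proof.
move=> TX TY; have tr2 Z : T Z -> \tr (Z *m Z) = 0.
  move=> /Tnil[k Zk]; apply: (@mxtrace_nilp _ _ _ k).
  by rewrite -[Z *m Z]/(Z ^+ 2) exprAC Zk expr0n.
have := tr2 _ (TD TX TY); rewrite mulmxDl !mulmxDr !mxtraceD !tr2 // add0r addr0.
rewrite [\tr (Y *m X)]mxtrace_mulC -mulr2n -mulr_natr => /eqP.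
by rewrite mulf_eq0 (negPf (natf_neq0_char0 charF 1)) orbF => /eqP.
Qed.

Lemma bracket_span_ad D X : bracket_span T D -> T X -> T (mxad D X).
Proof.
move=> spD TX; elim: spD => [|Y Z E TY TZ _ IH]; first by rewrite /mxad mul0mx mulmx0 subrr.
by rewrite mxadDl; apply: TD => //; apply: Ttrip.
Qed.

(* Cartan's criterion: the trace form vanishes on T, and the semisimple part of a
   sum of brackets is orthogonal to all its replicas. *)
Lemma bracket_span_nilp D : bracket_span T D -> exists k, D ^+ k = 0.
Proof.
move=> spD; have [g [q [sepq qS [k Nk]]]] := jordan_chevalley D charF.
set S := horner_mx D g in qS Nk.
have q0 : q != 0 by exact: separable_poly_neq0.
have [K [f [rs frs]]] := splitting_field q0.
have charK := pchar0_rmorph f charF.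
(* [q] kills [S] and has simple roots, all in [K]. *)
have [P uP /diagonalizable_forPex[d]] : diagonalizable (map_mx f S).
  apply/diagonalizableP; exists rs.
    rewrite -separable_prod_XsubC -(eqp_separable frs) separable_map.
    exact: sepq.
  rewrite -(eqp_dvdr _ frs); apply: mxminpoly_min.
  by rewrite -map_horner_mx qS map_mx0.
move=> /(simmxRL uP) ES.
pose c (X : 'M[F]_n.+1) := P *m map_mx f X *m invmx P.
have cM X Y : c (X *m Y) = c X *m c Y.
  by rewrite /c map_mxM !mulmxA mulmxKV.
have cD X Y : c (X + Y) = c X + c Y by rewrite /c map_mxD mulmxDr mulmxDl.
have cB X Y : c (X - Y) = c X - c Y by rewrite /c map_mxB mulmxBr mulmxBl.
have cad X Y : c (mxad X Y) = mxad (c X) (c Y) by rewrite /mxad cB !cM.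
have ctr X : \tr (c X) = f (\tr X).
  by rewrite /c mxtrace_mulC mulmxA mulVmx // mul1mx trace_map_mx.
pose T' Z := exists2 X, T X & Z = c X.
have DSN : diag_mx d + c (D - S) = c D by rewrite ES -cD addrC subrK.
have SN : S *m (D - S) = (D - S) *m S.
  rewrite mulmxBr mulmxBl; congr (_ - _).
  have := comm_horner_mx2 D g 'X; rewrite horner_mx_X; exact.
have cX m X : c (X ^+ m) = c X ^+ m.
  elim: m => [|m IH]; first by rewrite !expr0 /c map_mx1 mulmx1 mulmxV.
  by rewrite !exprS -!mulmxE cM IH.
have d0 : d = 0.
  apply: (@cartan_diag K n charK T' d (c (D - S)) k).
  - by rewrite ES -!cM SN.
  - by rewrite -cX Nk /c map_mx0 mulmx0 mul0mx.
  - move=> _ _ [X TX ->] [Y TY ->]; rewrite -cM ctr lts_trace_form //.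
    exact: rmorph0.
  - move=> _ [X TX ->]; rewrite DSN -cad; exists (mxad D X) => //.
    exact: bracket_span_ad.
  rewrite DSN; elim: spD => [|X Y E TX TY _ IH].
    by rewrite /c map_mx0 mulmx0 mul0mx; apply: bracket_span0.
  by rewrite cD cad; apply: bracket_spanS => //; [exists X | exists Y].
suff S0 : S = 0 by exists k; move: Nk; rewrite S0 subr0.
apply/eqP; rewrite -(map_mx_eq0 f); apply/eqP.
have : P *m map_mx f S *m invmx P = 0 by rewrite -ES d0; apply/matrixP => i j; rewrite !mxE mul0rn.
by move/(congr1 (fun Z => invmx P *m Z *m P)); rewrite !mulmxA mulVmx // mul1mx mulmxKV // mulmx0 mul0mx.
Qed.

End CartanNilpotent.

(** * The Engel-Jacobson theorem *)

Definition words_vanish (F : fieldType) n (T : 'M[F]_n.+1 -> Prop) k :=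
  forall s : seq 'M[F]_n.+1, (forall X, X \in s -> T X) -> (k <= size s)%N ->
  \prod_(X <- s) X = 0.

Lemma words_vanishW (F : fieldType) n (T U : 'M[F]_n.+1 -> Prop) k :
  (forall X, T X -> U X) -> words_vanish U k -> words_vanish T k.
Proof. by move=> TU hU s hs; apply: hU => X /hs /TU. Qed.

Section EngelStep.
Variables (F : fieldType) (n : nat) (E : {vspace 'M[F]_n.+1}) (k : nat).
Hypothesis Ek : words_vanish (fun X => X \in E) k.

(** The right ideal generated by products of [i] elements of [E], described by generators. *)
Inductive left_depth : nat -> 'M[F]_n.+1 -> Prop :=
| left_depth0 Z : left_depth 0 Z
| left_depthS X Z i : X \in E -> left_depth i Z -> left_depth i.+1 (X * Z)
| left_depth_zero i : left_depth i 0
| left_depthD i Z Z' : left_depth i Z -> left_depth i Z' -> left_depth i (Z + Z').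

Lemma left_depth_vanish Z : left_depth k Z -> Z = 0.
Proof.
suff h i s : left_depth i Z -> (forall X, X \in s -> X \in E) -> (k <= size s + i)%N ->
    \prod_(X <- s) X * Z = 0.
  by move=> dZ; have := h k [::] dZ; rewrite big_nil mul1r; apply.
move=> dZ; elim: dZ s => {i Z} [Z|X Z i XE _ IH|i|i Z Z' _ IH _ IH'] s sE ks.
- by rewrite Ek ?mul0r // -[size s]addn0.
- have := IH (rcons s X); rewrite -cats1 big_cat big_seq1 /= -mulrA cats1; apply.
    by move=> Y; rewrite mem_rcons inE => /predU1P[->|/sE].
  by rewrite size_rcons addSnnS.
- by rewrite mulr0.
by rewrite mulrDr IH // IH' // addr0.
Qed.

Lemma left_depth_pred i Z : left_depth i Z -> left_depth i.-1 Z.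
Proof.
elim=> {i Z} [Z|X Z i XE dZ IH|i|i Z Z' _ IH _ IH'].
- exact: left_depth0.
- by case: i dZ IH => [|i] dZ IH /=; [apply: left_depth0 | apply: left_depthS].
- exact: left_depth_zero.
exact: left_depthD.
Qed.

Lemma left_depthZ c i Z : left_depth i Z -> left_depth i (c *: Z).
Proof.
elim=> {i Z} [Z|X Z i XE dZ IH|i|i Z Z' _ IH _ IH'].
- exact: left_depth0.
- by rewrite scalerAr; apply: left_depthS.
- by rewrite scaler0; apply: left_depth_zero.
by rewrite scalerDr; apply: left_depthD.
Qed.

(** Expanding the brackets puts at least [k] letters of [E] on one side of [Z] in every term. *)
Lemma ad_words_vanish l Z : (forall X, X \in l -> X \in E) -> (k + k <= size l)%N ->
  foldl (fun Y X => mxad X Y) Z l = 0.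
Proof.
have foldlB l' Y Y' : foldl (fun Y X => mxad X Y) (Y - Y') l' =
    foldl (fun Y X => mxad X Y) Y l' - foldl (fun Y X => mxad X Y) Y' l'.
  by elim: l' Y Y' => //= X l' IH Y Y'; rewrite raddfB IH.
suff h s1 s2 : (forall X, X \in s1 -> X \in E) -> (forall X, X \in s2 -> X \in E) ->
    (forall X, X \in l -> X \in E) -> (k + k <= size s1 + size s2 + size l)%N ->
    foldl (fun Y X => mxad X Y) (\prod_(X <- s1) X * Z * \prod_(X <- s2) X) l = 0.
  by move=> lE kl; have := h [::] [::]; rewrite !big_nil mul1r mulr1; apply.
elim: l s1 s2 => [|X l IH] s1 s2 s1E s2E lE kl /=.
  have [ks1|s1k] := leqP k (size s1); first by rewrite (Ek s1E) // !mul0r.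
  rewrite (Ek s2E) ?mulr0 //; rewrite addn0 in kl.
  by rewrite -(leq_add2l k) (leq_trans kl) // leq_add2r ltnW.
have -> : mxad X (\prod_(Y <- s1) Y * Z * \prod_(Y <- s2) Y) =
    \prod_(Y <- X :: s1) Y * Z * \prod_(Y <- s2) Y -
    \prod_(Y <- s1) Y * Z * \prod_(Y <- rcons s2 X) Y.
  by rewrite big_cons -cats1 big_cat big_seq1 /= /mxad !mulmxE !mulrA.
have XE : X \in E by apply: lE; rewrite mem_head.
have lE' Y : Y \in l -> Y \in E by move=> Yl; apply: lE; rewrite inE Yl orbT.
rewrite foldlB !IH ?subrr //.
- by move=> Y; rewrite mem_rcons inE => /predU1P[->|/s2E].
- by rewrite size_rcons addnS addSn -addnS.
- by move=> Y; rewrite inE => /predU1P[->|/s1E].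
by rewrite /= !addSn -addnS.
Qed.

Variables (y : 'M[F]_n.+1) (N : nat).
Hypothesis yN : y ^+ N = 0.
Hypothesis adE : forall X, X \in E -> mxad X y \in E.

Lemma left_depth_mul_normalizer i Z : left_depth i Z -> left_depth i (y * Z).
Proof.
elim=> {i Z} [Z|X Z i XE dZ IH|i|i Z Z' _ IH _ IH'].
- exact: left_depth0.
- have -> : y * (X * Z) = X * (y * Z) + - mxad X y * Z.
    by rewrite /mxad !mulmxE opprB mulrBl !mulrA addrCA subrr addr0.
  by apply: left_depthD; apply: left_depthS => //; rewrite rpredN adE.
- by rewrite mulr0; apply: left_depth_zero.
by rewrite mulrDr; apply: left_depthD.
Qed.

(** Every block of [N] letters gains one unit of depth. Expand each letter along [E] and [y]: the
    term using only [y] contains [y ^+ N = 0], and any other contains a letter of [E], while [y]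
    preserves depth because it normalises [E]. *)
Lemma words_vanish_adjoin : words_vanish (fun X => X \in (E + <[y]>)%VS) (k * N).
Proof.
have dy i j Z : left_depth i Z -> left_depth i (y ^+ j * Z).
  elim: j => [|j IH] dZ; first by rewrite expr0 mul1r.
  by rewrite exprS -mulrA; apply/left_depth_mul_normalizer/IH.
suff h m s : (forall X, X \in s -> X \in (E + <[y]>)%VS) -> (m * N <= size s)%N ->
    left_depth m (\prod_(X <- s) X).
  by move=> s sE ks; apply/left_depth_vanish/h.
elim: m s => [|m IH] s sE ms; first exact: left_depth0.
rewrite -(cat_take_drop N s) big_cat /=.
have sz : size (take N s) = N.
  by rewrite size_takel // (leq_trans _ ms) // mulSn leq_addr.
have : left_depth m (\prod_(X <- drop N s) X).
  apply: IH => [X /mem_drop /sE //|].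
  by rewrite size_drop -(leq_add2l N) -mulSn subnKC // (leq_trans _ ms) // mulSn leq_addr.
have tE X : X \in take N s -> X \in (E + <[y]>)%VS by move/mem_take/sE.
move: (\prod_(X <- drop N s) X) (take N s) sz tE => Z t sz tE dZ.
suff [Z1 [Z2 [d1 d2 ->]]] : exists Z1 Z2, [/\ left_depth m Z1, left_depth m.+1 Z2 &
    \prod_(X <- t) X * Z = y ^+ size t * Z1 + Z2].
  by rewrite sz yN mul0r add0r.
elim: t tE {sz} => [|X t IHt] tE.
  exists Z, 0; rewrite big_nil expr0 addr0; split=> //; exact: left_depth_zero.
have [Z1 [Z2 [d1 d2 E2]]] := IHt (fun Y Yt => tE Y (mem_behead (Yt : Y \in behead (X :: t)))).
have /memv_addP[e eE [_ /vlineP[c ->] EX]] := tE X (mem_head _ _).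
rewrite big_cons -mulrA E2 EX mulrDl !mulrDr -!scalerAl [y * (_ * _)]mulrA -exprS.
exists (c *: Z1), (e * (y ^+ size t * Z1) + e * Z2 + c *: (y * Z2)); split.
- exact: left_depthZ.
- apply: left_depthD; last exact/left_depthZ/left_depth_mul_normalizer.
  apply: left_depthD; apply: left_depthS => //; first exact: dy.
  exact: left_depth_pred d2.
by rewrite -scalerAr addrCA !addrA.
Qed.

End EngelStep.

Section Engel.
Variables (F : fieldType) (n : nat) (W : 'M[F]_n.+1 -> Prop).
Hypothesis Wad : forall X Y, W X -> W Y -> W (mxad X Y).
Hypothesis Wnil : forall X, W X -> exists k, X ^+ k = 0.

(** Starting from [x], keep bracketing with elements of [ss] as long as the result stays outside the
    span. By [ad_words_vanish] this stops before [k + k] steps, at an element that normalises the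
    span and can be adjoined. *)
Lemma engel_step (ss : seq 'M[F]_n.+1) k : (forall X, X \in ss -> W X) ->
  words_vanish (fun X => X \in <<ss>>%VS) k -> (exists2 x, W x & x \notin <<ss>>%VS) ->
  exists2 y, W y & y \notin <<ss>>%VS /\
    exists k', words_vanish (fun X => X \in <<y :: ss>>%VS) k'.
Proof.
move=> ssW hk [x Wx xE].
have [y [Wy yE hy]] : exists y, [/\ W y, y \notin <<ss>>%VS &
    forall X, X \in ss -> mxad X y \in <<ss>>%VS].
  apply: NNPP => no.
  have next y : W y -> y \notin <<ss>>%VS -> exists2 X, X \in ss & mxad X y \notin <<ss>>%VS.
    move=> Wy yE; apply: NNPP => no2; apply: no; exists y; split=> // X Xss.
    by apply: contraT => nX; case: no2; exists X.
  have [l [sl lss [_ nl]]] : exists l, [/\ size l = (k + k)%N, (forall X, X \in l -> X \in ss) &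
      W (foldl (fun Y X => mxad X Y) x l) /\ foldl (fun Y X => mxad X Y) x l \notin <<ss>>%VS].
    elim: (k + k)%N => [|m [l [sl lss [Wl nl]]]]; first by exists [::].
    have [X Xss nX] := next _ Wl nl.
    exists (rcons l X); rewrite size_rcons sl foldl_rcons; split=> //.
      by move=> Y; rewrite mem_rcons inE => /predU1P[->|/lss].
    by split=> //; apply: Wad => //; apply: ssW.
  move: nl; rewrite (ad_words_vanish hk) ?mem0v ?sl // => X /lss.
  exact: memv_span.
exists y => //; split=> //; have [N yN] := Wnil Wy.
exists (k * N)%N; rewrite span_cons addvC; apply: words_vanish_adjoin => // X.
move=> Xss; rewrite (coord_span (X := in_tuple ss) Xss) /mxad mulmx_suml mulmx_sumr -sumrB.
apply: rpred_sum => i _; rewrite -scalemxAl -scalemxAr -scalerBr rpredZ //.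
by apply: hy; apply: mem_nth; exact: ltn_ord.
Qed.

(** The span of elements of [W] with vanishing words is enlarged until it contains [W]. Only the
    span is linear; [W] is merely closed under brackets. *)
Lemma engel_weakly_closed : exists k, words_vanish W k.
Proof.
suff [ss [k [ssW hk Wss]]] : exists ss k, [/\ forall X, X \in ss -> W X,
    words_vanish (fun X => X \in <<ss>>%VS) k & forall X, W X -> X \in <<ss>>%VS].
  by exists k; apply: words_vanishW hk.
have [ss [k [ssW hk]]] : exists ss k, (forall X, X \in ss -> W X) /\
    words_vanish (fun X => X \in <<ss>>%VS) k.
  exists [::], 1%N; split=> // s sE; case: s sE => // X s sE _.
  have := sE X (mem_head _ _); rewrite span_nil memv0 => /eqP ->.
  by rewrite big_cons mul0r.
have [m] := ubnP (\dim {:'M[F]_n.+1} - \dim <<ss>>); elim: m ss k ssW hk => // m IH ss k ssW hk dm.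
case: (classic (exists2 x, W x & x \notin <<ss>>%VS)) => [ex|nex]; last first.
  exists ss, k; split=> // X WX; apply: contraT => nX; case: nex; by exists X.
have [y Wy [yE [k' hk']]] := engel_step ssW hk ex.
apply: (IH (y :: ss) k') => //.
  by move=> X; rewrite inE => /predU1P[->|/ssW].
have sub : (<<ss>> <= <<y :: ss>>)%VS by rewrite span_cons addvSr.
have dlt : (\dim <<ss>> < \dim <<y :: ss>>)%N.
  rewrite ltn_neqAle dimvS // andbT; apply: contraNneq yE => Ed.
  have -> : <<ss>>%VS = <<y :: ss>>%VS by apply/eqP; rewrite eqEdim sub Ed leqnn.
  by rewrite memv_span // mem_head.
rewrite -ltnS; apply: leq_trans dm; rewrite ltnS; apply: ltn_sub2l => //.
by apply: leq_trans dlt _; apply/dimvS/subvf.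
Qed.
End Engel.

(** [T] together with the sums of its brackets is closed under brackets but not under addition.
    Nilpotency is known on the two pieces separately and not on their sum, hence the version of
    Engel's theorem for weakly closed sets. *)
Theorem engel_lts (F : fieldType) n (T : 'M[F]_n.+1 -> Prop) : [pchar F] =i pred0 ->
  T 0 -> (forall X Y, T X -> T Y -> T (X + Y)) ->
  (forall a X, T X -> T (a *: X)) ->
  (forall X, T X -> exists k, X ^+ k = 0) ->
  (forall X Y Z, T X -> T Y -> T Z -> T (mxad (mxad X Y) Z)) ->
  exists k, words_vanish T k.
Proof.
move=> charF T0 TD TZ Tnil Ttrip.
pose W X := T X \/ bracket_span T X.
have [k hk] : exists k, words_vanish W k.
  apply: engel_weakly_closed => [X Y|X]; last first.
    by case=> [/Tnil //|]; apply: bracket_span_nilp.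
  case=> hX; case=> hY.
  - by right; rewrite -[mxad X Y]addr0; apply: bracket_spanS => //; apply: bracket_span0.
  - left; rewrite mxadC -raddfN; apply: bracket_span_ad => //.
    by rewrite -scaleN1r; apply: TZ.
  - by left; apply: bracket_span_ad.
  right; elim: hY => {Y} [|Y Z D TY TZ' _ IH]; first by rewrite raddf0; apply: bracket_span0.
  rewrite mxadD (_ : mxad X (mxad Y Z) = mxad (mxad X Y) Z + mxad Y (mxad X Z)).
    rewrite -addrA; apply: bracket_spanS => //; first exact: bracket_span_ad.
    by apply: bracket_spanS => //; apply: bracket_span_ad.
  by rewrite mxad_jacobi subrK.
exists k; apply: words_vanishW hk => X; by left.
Qed.

Lemma span_ind (F : fieldType) (A : vectType F) (P : A -> Prop) (s : seq A) :
  P 0 -> (forall a x y, P x -> P y -> P (a *: x + y)) ->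
  (forall x, x \in s -> P x) -> forall x, x \in <<s>>%VS -> P x.
Proof.
move=> P0 Plin Ps x xs; rewrite (coord_span (X := in_tuple s) xs).
elim/big_rec: _ => // i y _; apply: Plin; apply: Ps; apply: mem_nth; exact: ltn_ord.
Qed.

(** By excluded middle, a list of elements of [P] is extended until it spans; the dimension bounds
    its growth. Subspaces can then be introduced by their defining property. *)
Lemma vspace_of_pred (F : fieldType) (A : vectType F) (P : A -> Prop) :
  P 0 -> (forall a x y, P x -> P y -> P (a *: x + y)) ->
  exists W : {vspace A}, forall x, x \in W <-> P x.
Proof.
move=> P0 Plin; suff [s [sP Ps]] : exists s, (forall x, x \in s -> P x) /\
    forall x, P x -> x \in <<s>>%VS.
  by exists <<s>>%VS => x; split; [apply: span_ind | apply: Ps].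
have : forall x : A, x \in [::] -> P x by [].
move: [::] => s; have [m] := ubnP (\dim {:A} - \dim <<s>>).
elim: m s => // m IH s dm sP.
case: (classic (exists2 x, P x & x \notin <<s>>%VS)) => [[x Px xs]|nex]; last first.
  exists s; split=> // x Px; apply: contraT => nx; case: nex; by exists x.
apply: (IH (x :: s)); last by move=> y; rewrite inE => /predU1P[->|/sP].
have sub : (<<s>> <= <<x :: s>>)%VS by rewrite span_cons addvSr.
have dlt : (\dim <<s>> < \dim <<x :: s>>)%N.
  rewrite ltn_neqAle dimvS // andbT; apply: contraNneq xs => Ed.
  have -> : <<s>>%VS = <<x :: s>>%VS by apply/eqP; rewrite eqEdim sub Ed leqnn.
  by rewrite memv_span // mem_head.
rewrite -ltnS; apply: leq_trans dm; rewrite ltnS; apply: ltn_sub2l => //.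
by apply: leq_trans dlt _; apply/dimvS/subvf.
Qed.

(** Bracketing with a polynomial in [M] amounts to [mxad M] followed by multiplications by powers of
    [M], which commute with [mxad M]; each such bracket therefore lowers the order of vanishing by
    one. *)
Lemma mxad_iter_horner (F : fieldType) n (M Z : 'M[F]_n.+1) g j :
  iter j (mxad M) Z = 0 -> iter j (mxad (horner_mx M g)) Z = 0.
Proof.
pose zr j Z := iter j (mxad M) Z = 0.
have zrD i X Y : zr i X -> zr i Y -> zr i (X + Y).
  rewrite /zr; have -> : iter i (mxad M) (X + Y) = iter i (mxad M) X + iter i (mxad M) Y.
    by elim: i => //= i ->; rewrite raddfD.
  by move=> -> ->; rewrite addr0.
have zr0 i : zr i 0 by rewrite /zr; elim: i => //= i ->; apply: raddf0.
have zrZ i c X : zr i X -> zr i (c *: X).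
  rewrite /zr; have -> : iter i (mxad M) (c *: X) = c *: iter i (mxad M) X.
    by elim: i => //= i ->; rewrite mxadZ.
  by move=> ->; rewrite scaler0.
have iterl i X : iter i (mxad M) (M * X) = M * iter i (mxad M) X.
  by elim: i => //= i ->; rewrite /mxad !mulmxE mulrBr !mulrA.
have iterr i X : iter i (mxad M) (X * M) = iter i (mxad M) X * M.
  by elim: i => //= i ->; rewrite /mxad !mulmxE mulrBl !mulrA.
have zrl i X p : zr i X -> zr i (horner_mx M p * X).
  move=> zX; elim/poly_ind: p => [|p c IH].
    by rewrite rmorph0 mul0r; apply: zr0.
  rewrite rmorphD rmorphM /= horner_mx_X horner_mx_C mulrDl; apply: zrD.
    have -> : horner_mx M p * M * X = M * (horner_mx M p * X).
      by rewrite mulrA; have := comm_horner_mx2 M p 'X; rewrite horner_mx_X => ->.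
    by rewrite /zr iterl IH mulr0.
  by rewrite -[_ * _]/(_ *m _) mul_scalar_mx; apply: zrZ.
have zrad i X p : zr i.+1 X -> zr i (mxad (horner_mx M p) X).
  move=> zX; elim/poly_ind: p => [|p c IH].
    by rewrite rmorph0 /mxad mul0mx mulmx0 subrr; apply: zr0.
  rewrite rmorphD rmorphM /= horner_mx_X horner_mx_C mxadDl.
  have -> : mxad c%:M X = 0 by rewrite /mxad scalar_mxC subrr.
  have -> : mxad (horner_mx M p * M) X = horner_mx M p * mxad M X + mxad (horner_mx M p) X * M.
    by rewrite /mxad !mulmxE mulrBr mulrBl !mulrA addrA subrK.
  rewrite addr0; apply: zrD; first by apply: zrl; move: zX; rewrite /zr iterSr.
  by rewrite /zr iterr IH mul0r.
elim: j Z => // j IH Z zZ; rewrite iterSr; apply: IH; exact: zrad.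
Qed.

Lemma mxtrace_comm_nilp (F : fieldType) n (Z N : 'M[F]_n.+1) k :
  Z *m N = N *m Z -> N ^+ k = 0 -> \tr (Z *m N) = 0.
Proof.
move=> ZN Nk; apply: (@mxtrace_nilp _ _ _ k).
by rewrite -[Z *m N]/(Z * N) exprMn_comm // Nk mulr0.
Qed.

(** * Algebras generated by a commutative triple system *)

Section LeftMultiplications.
Variables (F : fieldType) (A : vectType F) (mul : A -> A -> A) (one : A).
Hypothesis charF : [pchar F] =i pred0.
Hypothesis hbil : bilinear_mul mul.
Hypothesis hone : is_unit_elt mul one.
Variables (n : nat) (cv : {linear A -> 'cV[F]_n.+1}) (vc : 'cV[F]_n.+1 -> A).
Hypotheses (cvK : cancel cv vc) (vcK : cancel vc cv).

Lemma mulPl a x y z : mul (a *: x + y) z = a *: mul x z + mul y z.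
Proof. by case: hbil. Qed.
Lemma mulPr a x y z : mul x (a *: y + z) = a *: mul x y + mul x z.
Proof. by case: hbil. Qed.
Lemma mulDl x y z : mul (x + y) z = mul x z + mul y z.
Proof. by have := mulPl 1 x y z; rewrite !scale1r. Qed.
Lemma mulDr x y z : mul x (y + z) = mul x y + mul x z.
Proof. by have := mulPr 1 x y z; rewrite !scale1r. Qed.
Lemma mul0x x : mul 0 x = 0.
Proof. by apply: (addrI (mul 0 x)); rewrite -mulDl !addr0. Qed.
Lemma mulx0 x : mul x 0 = 0.
Proof. by apply: (addrI (mul x 0)); rewrite -mulDr !addr0. Qed.
Lemma mulZr a x y : mul x (a *: y) = a *: mul x y.
Proof. by rewrite -[a *: y]addr0 mulPr mulx0 addr0. Qed.
Lemma mulBr x y z : mul x (y - z) = mul x y - mul x z.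
Proof. by rewrite -scaleN1r mulDr mulZr scaleN1r. Qed.

(** [lin1_mx] acts on rows; the transpositions make [L x] act on columns, so that [L x *m L y] is
    left multiplication by [y] followed by that by [x]. *)
Definition lmx (x : A) : 'M[F]_n.+1 := (lin1_mx (fun u : 'rV_n.+1 => (cv (mul x (vc u^T)))^T))^T.
Local Notation L := lmx.
Local Notation v := (cv one).

Lemma vcP a u w : vc (a *: u + w) = a *: vc u + vc w.
Proof. by apply: (can_inj cvK); rewrite vcK linearP !vcK. Qed.

Lemma lmxE x y : L x *m cv y = cv (mul x y).
Proof.
apply: trmx_inj; rewrite trmx_mul trmxK /=.
pose f (u : 'rV[F]_n.+1) := (cv (mul x (vc u^T)))^T.
have flin : linear f.
  by move=> a u w; rewrite /f !linearP /= vcP mulPr !linearP.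
pose fL := GRing.isLinear.Build F _ _ _ f flin.
pose fM : {linear 'rV[F]_n.+1 -> 'rV[F]_n.+1} := HB.pack f fL.
have := mul_rV_lin1 fM (cv y)^T; rewrite /= /f trmxK cvK => ->.
by [].
Qed.

Lemma lmx_ext (M N : 'M[F]_n.+1) : (forall y, M *m cv y = N *m cv y) -> M = N.
Proof.
move=> h; apply/trmx_inj/row_matrixP => i; rewrite !rowE; apply: trmx_inj.
by rewrite !trmx_mul !trmxK -[(delta_mx 0 i)^T]vcK h.
Qed.

Lemma lmxP a x y : L (a *: x + y) = a *: L x + L y.
Proof. by apply: lmx_ext => z; rewrite mulmxDl -scalemxAl !lmxE mulPl linearP. Qed.
Lemma lmxD x y : L (x + y) = L x + L y.
Proof. by rewrite -[x]scale1r lmxP !scale1r. Qed.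
Lemma lmx0 : L 0 = 0.
Proof. by apply: (addrI (L 0)); rewrite -lmxD !addr0. Qed.
Lemma lmxZ a x : L (a *: x) = a *: L x.
Proof. by rewrite -[a *: x]addr0 lmxP lmx0 addr0. Qed.
Lemma lmxB x y : L (x - y) = L x - L y.
Proof. by rewrite -scaleN1r lmxD lmxZ scaleN1r. Qed.
Lemma lmx1 x : L x *m v = cv x.
Proof. by rewrite lmxE; case: (hone x) => _ ->. Qed.
Lemma lmx_one : L one = 1.
Proof. by apply: lmx_ext => y; rewrite lmxE mul1mx; case: (hone y) => ->. Qed.
Lemma lmx_inj : injective L.
Proof. by move=> x y /(congr1 (mulmx^~ v)); rewrite !lmx1 => /(can_inj cvK). Qed.

Lemma lmx_jp a x : in_LNalt mul a -> L (mul a x + mul x a) = mxjp (L a) (L x).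
Proof.
move=> ha; apply: lmx_ext => y; rewrite /mxjp mulmxDl -!mulmxA !lmxE -!raddfD mulDl.
congr (cv _); have := ha x y; rewrite /assoc opprB => /eqP.
by rewrite subr_eq addrAC -subr_eq opprK [X in _ == X]addrC => /eqP ->; rewrite addrC.
Qed.

Lemma lmx_mul a x : in_LNalt mul a ->
  L (mul a x) = 2%:R^-1 *: (mxjp (L a) (L x) + L (mul a x - mul x a)).
Proof.
move=> ha; rewrite -lmx_jp // -lmxD addrACA subrr addr0 -lmxZ -mulr2n -scaler_nat.
by rewrite scalerA mulVf ?(natf_neq0_char0 charF 1) // scale1r.
Qed.

Section Triple.
Variables a b c : A.
Hypotheses (ha : in_LNalt mul a) (hb : in_LNalt mul b) (hc : in_LNalt mul c).
Hypotheses (ab : mul a b = mul b a) (bc : mul b c = mul c b) (ac : mul a c = mul c a).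

(** With X o Y for [mxjp X Y], [[[X, Y], Z]] equals X o (Y o Z) - Y o (X o Z), and [lmx_jp] makes
    each iterated product a left multiplication. *)
Lemma lmx_trip : L (trip mul a b c) = mxad (mxad (L a) (L b)) (L c).
Proof.
have jp2 x y z : in_LNalt mul x -> in_LNalt mul y -> mul y z = mul z y ->
    mul x y = mul y x -> mul x z = mul z x -> mxjp (L x) (mxjp (L y) (L z)) =
    L (mul x (mul y z)) *+ 2 + L (mul y (mul x z)) + L (mul z (mul x y)).
  move=> hx hy yz xy xz; rewrite -!lmx_jp // mulr2n -!lmxD; congr (L _).
  rewrite -yz mulDr mulDl.
  (* The identity [lmx_jp] for [y] and [z], evaluated at [x]. *)
  have : cv (mul (mul y z) x) *+ 2 = cv (mul y (mul x z)) + cv (mul z (mul x y)).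
    rewrite xz xy; have := congr1 (mulmx^~ (cv x)) (lmx_jp z hy).
    rewrite /mxjp mulmxDl -!mulmxA !lmxE -yz -mulr2n => <-.
    by rewrite !mulr2n mulDl raddfD.
  rewrite mulr2n -!raddfD => /(can_inj cvK) ->.
  by rewrite addrA.
have e1 := jp2 a b c ha hb bc ab ac.
have e2 := jp2 b a c hb ha ac (esym ab) bc.
have -> : mxad (mxad (L a) (L b)) (L c) =
    mxjp (L a) (mxjp (L b) (L c)) - mxjp (L b) (mxjp (L a) (L c)).
  by rewrite /mxad /mxjp; mx_additive.
rewrite e1 e2 /trip ab addrNK lmxB.
by apply/matrixP => i j; rewrite !mxE; ring.
Qed.

End Triple.

(** * The centre in terms of left multiplications *)

Section Centre.

Lemma lmx_centre z x : in_centre mul z -> L (mul z x) = L z *m L x.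
Proof.
move=> hz; apply: lmx_ext => y; rewrite -mulmxA !lmxE; congr (cv _).
by have [_ [/eqP + _]] := hz x y; rewrite /assoc subr_eq0 => /eqP.
Qed.

Lemma lmx_centreC z x : in_centre mul z -> L z *m L x = L x *m L z.
Proof.
move=> hz; rewrite -lmx_centre //; have [-> _] := hz x x.
apply: lmx_ext => y; rewrite -mulmxA !lmxE; congr (cv _).
by have [_ [_ [/eqP + _]]] := hz x y; rewrite /assoc subr_eq0 => /eqP.
Qed.

Lemma centreP z : (forall x, L (mul z x) = L z *m L x) ->
  (forall x, L z *m L x = L x *m L z) -> in_centre mul z.
Proof.
move=> hM hC x y; have zC w : mul z w = mul w z.
  by apply: (can_inj cvK); rewrite -(lmx1 (mul z w)) hM hC -mulmxA lmx1 lmxE.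
have zA s t : mul (mul z s) t = mul z (mul s t).
  by apply: (can_inj cvK); rewrite -lmxE hM -mulmxA !lmxE.
have zCA s t : mul z (mul s t) = mul s (mul z t).
  by apply: (can_inj cvK); rewrite -!lmxE !mulmxA hC.
split=> //; rewrite /assoc zA subrr; split=> //.
by rewrite -zC zA zCA subrr -zC zCA -[mul y z]zC subrr.
Qed.

Lemma centre_one : in_centre mul one.
Proof. by apply: centreP => x; rewrite lmx_one ?mul1mx ?mulmx1 //; case: (hone x) => ->. Qed.

Lemma centre_lin a z w : in_centre mul z -> in_centre mul w -> in_centre mul (a *: z + w).
Proof.
move=> hz hw; apply: centreP => x.
  by rewrite mulPl !lmxP !lmx_centre // mulmxDl scalemxAl.
by rewrite lmxP mulmxDl mulmxDr -scalemxAl -scalemxAr !(lmx_centreC x).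
Qed.

Lemma centre0 : in_centre mul 0.
Proof. by apply: centreP => x; rewrite ?mul0x !lmx0 ?mulmx0 mul0mx. Qed.

Lemma centreM z w : in_centre mul z -> in_centre mul w -> in_centre mul (mul z w).
Proof.
move=> hz hw; apply: centreP => x.
  rewrite (lmx_centre w hz) -mulmxA -(lmx_centre x hw) -(lmx_centre _ hz).
  by congr (L _); have [_ [/eqP + _]] := hz w x; rewrite subr_eq0 => /eqP.
by rewrite (lmx_centre w hz) -mulmxA (lmx_centreC _ hw) mulmxA (lmx_centreC _ hz) mulmxA.
Qed.

Lemma centre_LNalt z : in_centre mul z -> in_LNalt mul z.
Proof. by move=> hz x y; have [_ [-> [-> _]]] := hz x y; rewrite oppr0. Qed.

Lemma LNalt_lin a x y : in_LNalt mul x -> in_LNalt mul y -> in_LNalt mul (a *: x + y).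
Proof.
move=> hx hy s t; have := hx s t; have := hy s t; rewrite /assoc !mulPl !mulPr !mulPl => ey ex.
have -> : a *: mul (mul x s) t + mul (mul y s) t - (a *: mul x (mul s t) + mul y (mul s t)) =
  a *: (mul (mul x s) t - mul x (mul s t)) + (mul (mul y s) t - mul y (mul s t)).
  by rewrite scalerBr opprD addrACA.
by rewrite ex ey scalerN -opprD scalerBr; congr (- _); rewrite opprD addrACA.
Qed.

End Centre.

(* A word has weight at least p and at most n letters; letters are closed under
   the triple product, so that brackets of letters can be pushed to the right
   end of a word, where they kill [one], without increasing the number of letters. *)
Section Words.
Variable Lt : nat -> A -> Prop.
Hypothesis LtLN : forall w b, Lt w b -> in_LNalt mul b.
Hypothesis LtC : forall i a j b, Lt i a -> Lt j b -> mul a b = mul b a.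
Hypothesis Lttrip : forall i a j b k c, Lt i a -> Lt j b -> Lt k c ->
  Lt (i + j + k) (trip mul a b c).

Inductive word_span : nat -> nat -> 'M[F]_n.+1 -> Prop :=
| word_span_centre z : in_centre mul z -> word_span 0 0 (L z)
| word_span_mul w b p m X : Lt w b -> word_span p m X -> word_span (w + p) m.+1 (L b *m X)
| word_span0 p m : word_span p m 0
| word_span_lin a p m X Y : word_span p m X -> word_span p m Y -> word_span p m (a *: X + Y)
| word_spanW p p' m m' X : (p' <= p)%N -> (m <= m')%N -> word_span p m X -> word_span p' m' X.

Lemma word_spanD p m X Y : word_span p m X -> word_span p m Y -> word_span p m (X + Y).
Proof. by move=> hX hY; rewrite -[X]scale1r; apply: word_span_lin. Qed.

Lemma word_spanZ a p m X : word_span p m X -> word_span p m (a *: X).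
Proof. by move=> hX; rewrite -[_ *: _]addr0; apply: word_span_lin => //; apply: word_span0. Qed.

Lemma word_span_centreM z p m X : in_centre mul z -> word_span p m X ->
  word_span p m (L z *m X).
Proof.
move=> hz; elim=> {p m X} [y hy|w b p m X hb _ IH|p m|a p m X Y _ IHX _ IHY|p p' m m' X pp mm _ IH].
- by rewrite -lmx_centre //; apply/word_span_centre/centreM.
- by rewrite mulmxA lmx_centreC // -mulmxA; apply: word_span_mul.
- by rewrite mulmx0; apply: word_span0.
- by rewrite mulmxDr -scalemxAr; apply: word_span_lin.
exact: word_spanW pp mm IH.
Qed.

Lemma word_spanM p m X q l Y : word_span p m X -> word_span q l Y ->
  word_span (p + q) (m + l) (X *m Y).
Proof.
move=> hX hY; elim: hX => {p m X} [y hy|w b p m X hb _ IH|p m|a p m X Z _ IHX _ IHZ|p p' m m' X pp mm _ IH].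
- exact: word_span_centreM.
- by rewrite -mulmxA -addnA addSn; apply: word_span_mul.
- by rewrite mul0mx; apply: word_span0.
- by rewrite mulmxDl -scalemxAl; apply: word_span_lin.
by apply: word_spanW IH; rewrite leq_add2r.
Qed.

Lemma word_span_letter w b : Lt w b -> word_span w 1 (L b).
Proof.
move=> hb; rewrite -[L b]mulmx1 -[1%:M]/(1 : 'M_n.+1) -lmx_one -[w]addn0.
exact/word_span_mul/word_span_centre/centre_one.
Qed.

Lemma mxad_letters_one i a j b : Lt i a -> Lt j b -> mxad (L a) (L b) *m v = 0.
Proof.
move=> ha hb; rewrite /mxad mulmxBl -!mulmxA !lmxE; case: (hone a) => _ ->.
by case: (hone b) => _ ->; rewrite (LtC ha hb) subrr.
Qed.

Lemma word_span_bracket i a j b p m X : Lt i a -> Lt j b -> word_span p m X ->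
  exists2 Y, word_span (i + j + p) m Y & mxad (L a) (L b) *m X *m v = Y *m v.
Proof.
move=> ha hb; elim=> {p m X} [z hz|w c p m X hc hX [Y hY EY]|p m|
  e p m X Z _ [Y hY EY] _ [Y' hY' EY']|p p' m m' X pp mm _ [Y hY EY]].
- exists 0; first exact: word_span0.
  rewrite mul0mx; have -> : mxad (L a) (L b) *m L z = L z *m mxad (L a) (L b).
    rewrite /mxad mulmxBl mulmxBr -!mulmxA -!(lmx_centreC _ hz) !mulmxA.
    by rewrite !(lmx_centreC _ hz).
  by rewrite -mulmxA (mxad_letters_one ha hb) mulmx0.
- exists (L (trip mul a b c) *m X + L c *m Y); last first.
    rewrite mulmxDl -[L c *m Y *m v]mulmxA -EY.
    rewrite (lmx_trip (LtLN ha) (LtLN hb) (LtC ha hb) (LtC hb hc) (LtC ha hc)).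
    move: (mxad (L a) (L b)) => D.
    by rewrite /mxad !mulmxA !mulmxBl subrK.
  apply: word_spanD; last first.
    apply: (@word_spanW (w + (i + j + p)) _ m.+1) => //; first by rewrite addnCA.
    exact: word_span_mul.
  by rewrite addnA; apply: word_span_mul => //; apply: Lttrip.
- by exists 0; [exact: word_span0 | rewrite mulmx0].
- exists (e *: Y + Y'); first exact: word_span_lin.
  by move: EY EY'; move: (mxad _ _) => D EY EY'; rewrite mulmxDr !mulmxDl -scalemxAr -!scalemxAl EY EY'.
exists Y => //; apply: word_spanW hY => //; by rewrite leq_add2l.
Qed.

(** Bracketing with [L b] replaces one letter [L c] of a word by [[L b, L c]], which
    [word_span_bracket] moves away at [v]. The result has the weight of [b] added but no additional
    letter, which keeps the induction on letters going. *)
Lemma word_span_ad w b p m X : Lt w b -> word_span p m X ->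
  exists2 Y, word_span (w + p) m Y & mxad (L b) X *m v = Y *m v.
Proof.
move=> hb; elim=> {p m X} [z hz|u c p m X hc hX [Y hY EY]|p m|
  e p m X Z _ [Y hY EY] _ [Y' hY' EY']|p p' m m' X pp mm _ [Y hY EY]].
- by exists 0; [exact: word_span0 | rewrite /mxad (lmx_centreC _ hz) subrr].
- have [Z hZ EZ] := word_span_bracket hb hc hX.
  exists (Z + L c *m Y); last first.
    rewrite [RHS]mulmxDl -[L c *m Y *m v]mulmxA -EY -EZ /mxad.
    by rewrite !mulmxBl mulmxBr !mulmxA addrA subrK.
  apply: word_spanD; first by rewrite addnA; apply: word_spanW hZ.
  by rewrite addnCA; apply: word_span_mul.
- by exists 0; [exact: word_span0 | rewrite raddf0].
- exists (e *: Y + Y'); first exact: word_span_lin.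
  by rewrite mxadD mxadZ (mulmxDl (e *: _)) (mulmxDl (e *: Y)) -!scalemxAl EY EY'.
exists Y => //; apply: word_spanW hY => //; by rewrite leq_add2l.
Qed.

Lemma word_span_letterr w b p m X : Lt w b -> word_span p m X ->
  word_span (w + p) m.+1 (X *m L b).
Proof. by move=> hb hX; rewrite addnC -addn1; apply/word_spanM/word_span_letter. Qed.

(** For [x = b y], [lmx_mul] calls for both [y] and the commutator [b y - y b]. By [word_span_ad]
    each is represented with one letter less than [x], once [L y] is known to be a sum of words; so
    the word property and [P] are proved together. *)
Lemma word_vector_ind (P : A -> Prop) :
  P 0 -> (forall a x y, P x -> P y -> P (a *: x + y)) ->
  (forall z, in_centre mul z -> P z) ->
  (forall w b y, Lt w b -> P y -> P (mul b y - mul y b) -> P (mul b y)) ->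
  forall p m X x, word_span p m X -> cv x = X *m v -> word_span p m (L x) /\ P x.
Proof.
move=> P0 Plin Pz Pm p m X x hX; have [N] := ubnP m.
elim: N p m X x hX => // N IHN p m X x hX; elim: hX x => {p m X}
  [z hz|w b p m X hb hX _|p m|e p m X Z _ IHX _ IHZ|p p' m m' X pp mm _ IH] x mN Ex.
- have -> : x = z by apply: (can_inj cvK); rewrite Ex lmx1.
  by split; [apply: word_span_centre | apply: Pz].
- pose y := vc (X *m v); have Ey : cv y = X *m v by rewrite vcK.
  have [hy Py] := IHN _ _ _ y hX mN Ey.
  have Dx : x = mul b y by apply: (can_inj cvK); rewrite Ex -mulmxA -Ey lmxE.
  have [Y hY EY] := word_span_ad hb hy.
  have Ec : cv (mul b y - mul y b) = Y *m v.
    by rewrite -EY /mxad mulmxBl -!mulmxA !lmx1 !lmxE raddfB.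
  have [hc Pc] := IHN _ _ _ _ hY mN Ec.
  split; last by rewrite Dx; apply: Pm hb Py Pc.
  have -> : L x = 2%:R^-1 *: (L b *m L y + L y *m L b + L (mul b y - mul y b)).
    by rewrite Dx -[_ + _ *m _]/(mxjp (L b) (L y)) -lmx_mul //; exact: LtLN hb.
  apply/word_spanZ/word_spanD; last by apply: word_spanW hc.
  by apply: word_spanD; [apply: word_span_mul | apply: word_span_letterr].
- have -> : x = 0 by apply: (can_inj cvK); rewrite Ex mul0mx raddf0.
  by rewrite lmx0; split=> //; apply: word_span0.
- have Dx : x = e *: vc (X *m v) + vc (Z *m v).
    by apply: (can_inj cvK); rewrite Ex linearP /= !vcK mulmxDl scalemxAl.
  have [h1 P1] := IHX (vc (X *m v)) mN (vcK _).
  have [h2 P2] := IHZ (vc (Z *m v)) mN (vcK _).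
  by rewrite Dx lmxP; split; [apply: word_span_lin | apply: Plin].
have [h1 P1] := IH x (leq_ltn_trans mm mN) Ex.
by split=> //; apply: word_spanW h1.
Qed.

Lemma word_span_lmx p m X x : word_span p m X -> cv x = X *m v -> word_span p m (L x).
Proof.
move=> hX Ex; have [] := @word_vector_ind (fun=> True) I (fun _ _ _ _ _ => I)
  (fun _ _ => I) (fun _ _ _ _ _ _ => I) _ _ _ _ hX Ex.
by [].
Qed.

Variable V : {vspace A}.
Hypothesis hgen : generates_unital mul one V.
Hypothesis VLt : forall x, x \in V -> exists m, word_span 0 m (L x).

Lemma word_span_full x : exists m, word_span 0 m (L x).
Proof.
have [|a y z [m hm] [l hl]|U hU] := @vspace_of_pred F A (fun x => exists m, word_span 0 m (L x)).
- by exists 0%N; rewrite lmx0; apply: word_span0.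
- exists (maxn m l); rewrite lmxP; apply: word_span_lin.
    by apply: word_spanW hm => //; apply: leq_maxl.
  by apply: word_spanW hl => //; apply: leq_maxr.
have UT : U = fullv.
  apply: hgen => [||y z /hU[m hm] /hU[l hl]].
  - by apply/hU; exists 0%N; apply/word_span_centre/centre_one.
  - by apply/subvP => y yV; apply/hU/VLt.
  apply/hU; exists (m + l)%N; apply: word_span_lmx (word_spanM hm hl) _.
  by rewrite -mulmxA lmx1 lmxE.
by apply/hU; rewrite UT memvf.
Qed.

Lemma word_gen_ind (P : A -> Prop) :
  P 0 -> (forall a x y, P x -> P y -> P (a *: x + y)) ->
  (forall z, in_centre mul z -> P z) ->
  (forall w b y, Lt w b -> P y -> P (mul b y - mul y b) -> P (mul b y)) ->
  forall x, P x.
Proof.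
move=> P0 Plin Pz Pm x; have [m hm] := word_span_full x.
by have [] := word_vector_ind P0 Plin Pz Pm hm (esym (lmx1 x)).
Qed.

End Words.

(** * Central semisimple parts of the generators *)

Section GeneratingSystem.
Variable V : {vspace A}.
Hypothesis hVLN : forall a, a \in V -> in_LNalt mul a.
Hypothesis hVsub : forall a b c, a \in V -> b \in V -> c \in V -> trip mul a b c \in V.
Hypothesis hVcomm : forall a b, a \in V -> b \in V -> mul a b = mul b a.
Hypothesis hgen : generates_unital mul one V.

Lemma lmx_tripV a b c : a \in V -> b \in V -> c \in V ->
  L (trip mul a b c) = mxad (mxad (L a) (L b)) (L c).
Proof. by move=> aV bV cV; apply: lmx_trip; first [exact: hVLN | exact: hVcomm]. Qed.

Lemma gen_ind (P : A -> Prop) :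
  P 0 -> (forall a x y, P x -> P y -> P (a *: x + y)) ->
  (forall z, in_centre mul z -> P z) ->
  (forall b y, b \in V -> P y -> P (mul b y - mul y b) -> P (mul b y)) ->
  forall x, P x.
Proof.
(* Every weight is given the same letters, namely [V]. *)
move=> P0 Plin Pz Pm; have LN (w : nat) b : b \in V -> in_LNalt mul b by exact: hVLN.
have com (i : nat) a (j : nat) b : a \in V -> b \in V -> mul a b = mul b a by exact: hVcomm.
have tri (i : nat) a (j : nat) b (k : nat) c :
  a \in V -> b \in V -> c \in V -> trip mul a b c \in V by exact: hVsub.
apply: (word_gen_ind LN com tri hgen) => // x xV.
by exists 1%N; exact: (@word_span_letter (fun _ b => b \in V) 0).
Qed.

Lemma ad_lmx_nilp a b : a \in V -> b \in V -> exists k, iter k (mxad (L a)) (L b) = 0.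
Proof.
move=> aV bV.
apply: (@mxad_nilpotent F n charF (L a) v (fun X => exists2 b, b \in V & X = L b)
          (fun X => exists x, X = L x)); last by exists b.
- by move=> _ [x _ ->]; exists x.
- by move=> _ _ [x ->] [y ->]; exists (x + y); rewrite lmxD.
- by move=> c _ [x ->]; exists (c *: x); rewrite lmxZ.
- by move=> _ [x ->]; exists (mul a x + mul x a); rewrite lmx_jp //; exact: hVLN.
- by move=> _ [x ->]; rewrite lmx1 => /(congr1 vc); rewrite cvK -[0](raddf0 cv) cvK => ->; exact: lmx0.
- move=> _ [x xV ->]; exists (trip mul x a a); first exact: hVsub.
  by rewrite lmx_tripV // [RHS]mxadC (mxadC (L x)) raddfN opprK.
move=> _ [x xV ->]; rewrite /mxad mulmxBl -!mulmxA !lmx1 !lmxE.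
by rewrite (hVcomm aV xV) subrr.
Qed.

(** Both operator identities of [centreP] spread from [V] to [A] by [gen_ind], since [lmx_mul]
    expresses [L (b y)] through [L b], [L y] and the commutator. *)
Lemma comm_centre z : (forall b, b \in V -> L z *m L b = L b *m L z) -> in_centre mul z.
Proof.
move=> zV.
have zA : forall x, L z *m L x = L x *m L z.
  apply: gen_ind => [|a x y hx hy|y hy|b y bV hy hc].
  - by rewrite lmx0 mulmx0 mul0mx.
  - by rewrite lmxP mulmxDr mulmxDl -scalemxAr -scalemxAl hx hy.
  - by rewrite (lmx_centreC _ hy).
  rewrite (lmx_mul _ (hVLN bV)) -scalemxAr -scalemxAl; congr (_ *: _).
  rewrite /mxjp !mulmxDr !mulmxDl hc; congr (_ + _).
  by rewrite -!mulmxA -hy !mulmxA hy zV // -!mulmxA hy zV.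
apply: centreP => //; apply: gen_ind => [|a x y hx hy|y hy|b y bV hy hc].
- by rewrite mulx0 lmx0 mulmx0.
- by rewrite mulPr !lmxP mulmxDr -scalemxAr hx hy.
- have -> : mul z y = mul y z by have [] := hy z z.
  by rewrite lmx_centre // lmx_centreC.
have zmul s t : mul z (mul s t) = mul s (mul z t).
  by apply: (can_inj cvK); rewrite -lmxE -(lmxE s t) mulmxA zA -mulmxA !lmxE.
(* Multiplication by [z] passes inside the commutator, so [hc] covers the commutator of [b] with
   [mul z y]. *)
have zb : mul z (mul b y) - mul z (mul y b) = mul b (mul z y) - mul (mul z y) b.
  rewrite zmul; congr (_ - _); apply: (can_inj cvK).
  by rewrite -(lmxE (mul z y)) hy -mulmxA !lmxE.
rewrite zmul (lmx_mul _ (hVLN bV)) -zb -mulBr hc.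
rewrite (lmx_mul y (hVLN bV)) -scalemxAr; congr (_ *: _).
by rewrite /mxjp !mulmxDr hy !mulmxA (zA b).
Qed.

(** Polynomials in [L a] are again left multiplications, so the semisimple part of [L a] is some
    [L s]. Brackets with [L s] are nilpotent on [L V] like those with [L a], and semisimplicity
    makes them zero. *)
Lemma central_semisimple_part a : a \in V -> exists s, [/\ in_centre mul s,
  exists2 q : {poly F}, separable_poly q & horner_mx (L s) q = 0 &
  exists k, L (a - s) ^+ k = 0].
Proof.
move=> aV; have [g [q [sepq qS [k Nk]]]] := jordan_chevalley (L a) charF.
have [s Es] : exists s, horner_mx (L a) g = L s.
  elim/poly_ind: g {qS Nk} => [|p c [h Eh]]; first by exists 0; rewrite rmorph0 lmx0.
  exists (2%:R^-1 *: (mul a h + mul h a) + c *: one).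
  rewrite lmxP (lmx_jp _ (hVLN aV)) lmxZ lmx_one rmorphD rmorphM /= horner_mx_X horner_mx_C.
  rewrite -scalemx1; congr (_ + _); rewrite /mxjp.
  have <- : horner_mx (L a) p *m L a = L a *m L h.
    by have := comm_horner_mx2 (L a) p 'X; rewrite horner_mx_X Eh.
  by rewrite Eh -mulr2n -scaler_nat scalerA mulVf ?(natf_neq0_char0 charF 1) // scale1r.
rewrite Es in qS Nk; exists s; split; last 2 first.
- by exists q.
- by exists k; rewrite lmxB.
apply: comm_centre => b bV; have [j Ej] := ad_lmx_nilp aV bV.
apply: (separable_comm sepq qS (k := j)); rewrite -Es.
exact: mxad_iter_horner Ej.
Qed.

(** The [L (s_ i)] commute, hence are simultaneously diagonal over some [K]. Taking all central
    elements diagonal in that basis gives closure under products at once, and a nilpotent diagonal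
    matrix is 0. *)
Lemma semisimple_subalgebra (I : finType) (s_ : I -> A) :
  (forall i, in_centre mul (s_ i)) ->
  (forall i, exists2 q : {poly F}, separable_poly q & horner_mx (L (s_ i)) q = 0) ->
  exists Q : {vspace A}, [/\ one \in Q, forall i, s_ i \in Q, mul_closed mul Q,
    forall q, q \in Q -> in_centre mul q &
    forall q, q \in Q -> (exists k, L q ^+ k = 0) -> q = 0].
Proof.
move=> sC sS; have [q_ hq] : exists q_ : I -> {poly F},
    forall i, separable_poly (q_ i) /\ horner_mx (L (s_ i)) (q_ i) = 0.
  apply: (@fin_all_exists I (fun=> {poly F})
    (fun i q => separable_poly q /\ horner_mx (L (s_ i)) q = 0)) => i.
  by have [q ? ?] := sS i; exists q.
have q0 : \prod_i q_ i != 0.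
  by apply/prodf_neq0 => i _; apply: separable_poly_neq0; case: (hq i).
have [K [f [rs frs]]] := splitting_field q0.
have [P uP Pdiag] : codiagonalizable [seq map_mx f (L (s_ i)) | i : I].
  apply/codiagonalizableP; split=> [_ _ /imageP[i _ ->] /imageP[j _ ->]|_ /imageP[i _ ->]].
    by rewrite /comm_mx -!map_mxM lmx_centreC.
  have [sepq qs] := hq i; have : map_poly f (q_ i) %| \prod_(r <- rs) ('X - r%:P).
    by rewrite -(eqp_dvdr _ frs) dvdp_map (bigD1 i) //= dvdp_mulr.
  case/dvdp_prod_XsubC=> m /= Em; apply/diagonalizableP; exists (mask m rs).
    by rewrite -separable_prod_XsubC -(eqp_separable Em) separable_map.
  rewrite -(eqp_dvdr _ Em); apply: mxminpoly_min.
  by rewrite -map_horner_mx qs map_mx0.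
pose c (X : 'M[F]_n.+1) := P *m map_mx f X *m invmx P.
have cM X Y : c (X *m Y) = c X *m c Y by rewrite /c map_mxM !mulmxA mulmxKV.
have cX X k : c (X ^+ k) = c X ^+ k.
  elim: k => [|k IH]; first by rewrite !expr0 /c map_mx1 mulmx1 mulmxV.
  by rewrite !exprS -!mulmxE cM IH.
have c0 : c 0 = 0 by rewrite /c map_mx0 mulmx0 mul0mx.
have clin a X Y : c (a *: X + Y) = f a *: c X + c Y.
  by rewrite /c map_mxD map_mxZ mulmxDr mulmxDl -scalemxAr -scalemxAl.
pose inQ z := in_centre mul z /\ exists d, c (L z) = diag_mx d.
have [|a x y [xC [d Ed]] [yC [e Ee]]|Q hQ] := @vspace_of_pred F A inQ.
- by split; [exact: centre0 | exists 0; rewrite lmx0 c0 raddf0].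
- split; first exact: centre_lin.
  by exists (f a *: d + e); rewrite lmxP clin Ed Ee linearP.
exists Q; split.
- apply/hQ; split; first exact: centre_one.
  exists (const_mx 1); rewrite diag_const_mx lmx_one /c map_mx1 mulmx1 mulmxV //.
- move=> i; apply/hQ; split=> //.
  have /(allP Pdiag) /diag_mxP[d Ed] : map_mx f (L (s_ i)) \in [seq map_mx f (L (s_ j)) | j : I].
    by apply/imageP; exists i.
  by exists d; rewrite -Ed conjumx.
- move=> x y /hQ[xC [d Ed]] /hQ[yC [e Ee]]; apply/hQ; split; first exact: centreM.
  by rewrite lmx_centre // cM Ed Ee mulmx_diag; eexists.
- by move=> q /hQ[].
move=> q /hQ[_ [d Ed]] [k qk].
have : diag_mx (map_mx (horner 'X^k) d) = 0.
  by rewrite -horner_mx_diag rmorphXn /= horner_mx_X -Ed -cX qk c0.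
move=> dk; have d0 : d = 0.
  apply/rowP => j; have := congr1 (fun M : 'M_n.+1 => M j j) dk.
  rewrite !mxE eqxx mulr1n hornerXn => /eqP.
  by rewrite expf_eq0 => /andP[_ /eqP].
apply: lmx_inj; rewrite lmx0; apply/eqP; rewrite -(map_mx_eq0 f); apply/eqP.
have : c (L q) = 0 by rewrite Ed d0 raddf0.
move/(congr1 (fun Z => invmx P *m Z *m P)); rewrite /c !mulmxA mulVmx // mul1mx.
by rewrite mulmxKV // mulmx0 mul0mx.
Qed.

(** * The triple system of nilpotent parts *)

Section Decomposition.
Variables (s_ : 'I_(\dim V) -> A) (Q : {vspace A}).
Hypothesis sNil : forall i : 'I_(\dim V), exists k, L ((vbasis V)`_i - s_ i) ^+ k = 0.
Hypothesis sQ : forall i, s_ i \in Q.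
Hypothesis Qone : one \in Q.
Hypothesis QM : mul_closed mul Q.
Hypothesis QC : forall q, q \in Q -> in_centre mul q.
Hypothesis Qred : forall q, q \in Q -> (exists k, L q ^+ k = 0) -> q = 0.

(** Extended linearly from the basis of [V]: linearity of the two parts is then free, and nilpotency
    of [nil_part x] becomes what has to be proved. *)
Definition ss_part x : A := \sum_i coord (vbasis V) i x *: s_ i.
Definition nil_part x : A := x - ss_part x.

Lemma ss_partP a x y : ss_part (a *: x + y) = a *: ss_part x + ss_part y.
Proof.
rewrite /ss_part scaler_sumr -big_split /=; apply: eq_bigr => i _.
by rewrite linearP scalerDl scalerA.
Qed.

Lemma nil_partP a x y : nil_part (a *: x + y) = a *: nil_part x + nil_part y.
Proof. by rewrite /nil_part ss_partP scalerBr opprD addrACA. Qed.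

Lemma nil_partD x y : nil_part (x + y) = nil_part x + nil_part y.
Proof. by have := nil_partP 1 x y; rewrite !scale1r. Qed.

Lemma nil_part0 : nil_part 0 = 0.
Proof. by apply: (addrI (nil_part 0)); rewrite -nil_partD !addr0. Qed.

Lemma nil_partZ a x : nil_part (a *: x) = a *: nil_part x.
Proof. by rewrite -[a *: x]addr0 nil_partP nil_part0 addr0. Qed.

Lemma ss_part_Q x : ss_part x \in Q.
Proof. by apply: rpred_sum => i _; apply: rpredZ. Qed.

Lemma nil_part_sum x : x \in V ->
  nil_part x = \sum_i coord (vbasis V) i x *: ((vbasis V)`_i - s_ i).
Proof.
move=> xV; rewrite /nil_part {1}(coord_vbasis xV) /ss_part -sumrB.
by apply: eq_bigr => i _; rewrite scalerBr.
Qed.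

(* The summands [(vbasis V)`_i - s_ i] of [nil_part x] are nilpotent; at this point
   [nil_part x] itself is not known to be. *)
Lemma mxtrace_centre_nil_part z x k : in_centre mul z -> x \in V ->
  \tr (L z ^+ k *m L (nil_part x)) = 0.
Proof.
move=> zC xV; rewrite (nil_part_sum xV).
elim/big_ind: _ => [|y w Ey Ew|i _].
- by rewrite lmx0 mulmx0 mxtrace0.
- by rewrite lmxD mulmxDr mxtraceD Ey Ew addr0.
have [j Nj] := sNil i; rewrite lmxZ -scalemxAr mxtraceZ.
rewrite (@mxtrace_comm_nilp _ _ _ _ j) ?mulr0 //.
have := commrX k (esym (lmx_centreC ((vbasis V)`_i - s_ i) zC)).
by move=> /esym.
Qed.

Lemma lmx_centre_nilp y : in_centre mul y ->
  (forall k, \tr (L y ^+ k *m L y) = 0) -> exists k, L y ^+ k = 0.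
Proof.
move=> yC tr0; apply: nilp_of_mxtrace => // k.
by rewrite exprSr; exact: tr0.
Qed.

(** Compare [ss_part x] with the semisimple part [t] of [x] itself. Their difference is central and
    trace-orthogonal to its own powers, hence nilpotent; [nil_part x] is the sum of it and of
    [x - t], two commuting nilpotents. *)
Lemma nil_part_nilp x : x \in V -> exists k, L (nil_part x) ^+ k = 0.
Proof.
move=> xV; have [t [tC _ [j Nj]]] := central_semisimple_part xV.
have yC : in_centre mul (t - ss_part x).
  by rewrite -scaleN1r addrC; apply: centre_lin => //; apply/QC/ss_part_Q.
have Ey : t - ss_part x = nil_part x - (x - t).
  by rewrite /nil_part opprB [x - _]addrC addrACA [- _ + t]addrC subrr addr0 addrC.
have [i Hi] : exists k, L (t - ss_part x) ^+ k = 0.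
  apply: lmx_centre_nilp => // k.
  rewrite {2}Ey (lmxB (nil_part x)) mulmxBr raddfB /= mxtrace_centre_nil_part // sub0r.
  rewrite (@mxtrace_comm_nilp _ _ _ _ j) ?oppr0 //.
  by have := commrX k (esym (lmx_centreC (x - t) yC)) => /esym.
have -> : nil_part x = (t - ss_part x) + (x - t).
  by rewrite Ey subrK.
exists (i + j)%N; rewrite lmxD exprDn_comm; last exact: lmx_centreC.
apply: big1 => l _.
have [il|li] := leqP j l.
  by rewrite -(subnKC il) [L (x - t) ^+ _]exprD Nj mul0r mulr0 mul0rn.
have hl : (i <= i + j - l)%N by rewrite -addnBA ?leq_addr // ltnW.
by rewrite -(subnKC hl) exprD Hi !mul0r mul0rn.
Qed.

Lemma mxad_nil_part x w : mxad (L (nil_part x)) (L w) = mxad (L x) (L w).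
Proof.
rewrite /nil_part lmxB /mxad mulmxBl mulmxBr (lmx_centreC w (QC (ss_part_Q x))).
by rewrite opprB addrA subrK.
Qed.

(** A bracket is trace-orthogonal to the powers of a central multiplication commuting with its
    factor [L z]. So the semisimple part of a triple product is nilpotent, hence 0 in [Q]; this is
    what closes the nilpotent parts under triple products. *)
Lemma ss_part_trip x y z : x \in V -> y \in V -> z \in V ->
  ss_part (trip mul x y z) = 0.
Proof.
move=> xV yV zV; set t := trip mul x y z; have tV : t \in V by exact: hVsub.
have sC := QC (ss_part_Q t); apply: Qred; first exact: ss_part_Q.
apply: lmx_centre_nilp => // k.
have {2}-> : ss_part t = t - nil_part t by rewrite /nil_part opprB addrC subrK.
rewrite lmxB mulmxBr raddfB /= mxtrace_centre_nil_part // subr0 lmx_tripV //.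
have YZ : L (ss_part t) ^+ k *m L z = L z *m L (ss_part t) ^+ k.
  by have := commrX k (esym (lmx_centreC z sC)) => /esym.
move: (mxad (L x) (L y)) (L (ss_part t) ^+ k) YZ => D Y YZ.
by rewrite /mxad mulmxBr raddfB /= !mulmxA YZ -[L z *m Y *m D]mulmxA [X in _ - X]mxtrace_mulC subrr.
Qed.

Lemma lmx_trip_nil_part x y z : x \in V -> y \in V -> z \in V ->
  mxad (mxad (L (nil_part x)) (L (nil_part y))) (L (nil_part z)) = L (trip mul x y z).
Proof.
move=> xV yV zV; have adC w u : mxad (L w) (L (ss_part u)) = 0.
  by rewrite /mxad (lmx_centreC w (QC (ss_part_Q u))) subrr.
rewrite mxad_nil_part (mxadC (L x)) mxad_nil_part -(mxadC (L x)) lmx_tripV //.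
by rewrite /nil_part lmxB raddfB /= (mxad_jacobi _ _ (L (ss_part z))) !adC !mxad0 !subr0.
Qed.

Lemma nil_part_trip x y z : x \in V -> y \in V -> z \in V ->
  nil_part (trip mul x y z) = trip mul x y z.
Proof. by move=> xV yV zV; rewrite /nil_part ss_part_trip // subr0. Qed.

Lemma nil_part_words_vanish : exists k,
  words_vanish (fun X => exists2 x, x \in V & X = L (nil_part x)) k.
Proof.
apply: engel_lts => //.
- by exists 0; [exact: mem0v | rewrite nil_part0 lmx0].
- move=> _ _ [x xV ->] [y yV ->]; exists (x + y); first by rewrite rpredD.
  by rewrite nil_partD lmxD.
- move=> a _ [x xV ->]; exists (a *: x); first by rewrite rpredZ.
  by rewrite nil_partZ lmxZ.
- by move=> _ [x xV ->]; exact: nil_part_nilp.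
move=> _ _ _ [x xV ->] [y yV ->] [z zV ->]; exists (trip mul x y z); first exact: hVsub.
by rewrite lmx_trip_nil_part // nil_part_trip.
Qed.

(** * Depth filtration, nilpotency of [V] and the nilpotent ideal *)

Section Depth.
Variables (E : {vspace 'M[F]_n.+1}) (k : nat).
Hypothesis EP : forall X, X \in E <-> exists2 x, x \in V & X = L (nil_part x).
Hypothesis Ek : words_vanish (fun X => X \in E) k.

(** A degree for operators, additive under products: central multiplications have degree 0, elements
    of [E] degree 1, and degree [k] forces 0. *)
Definition raises p (X : 'M[F]_n.+1) :=
  forall i Z, left_depth E i Z -> left_depth E (i + p) (X *m Z).

Lemma left_depthW i j Z : (j <= i)%N -> left_depth E i Z -> left_depth E j Z.
Proof.
move/subnKC => <-; elim: (i - j)%N => [|l IH]; first by rewrite addn0.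
by rewrite addnS => /left_depth_pred.
Qed.

Lemma raisesW p q X : (p <= q)%N -> raises q X -> raises p X.
Proof. by move=> pq hX i Z /hX; apply: left_depthW; rewrite leq_add2l. Qed.

Lemma raisesM p q X Y : raises p X -> raises q Y -> raises (p + q) (X *m Y).
Proof.
by move=> hX hY i Z /hY /hX; rewrite mulmxA -addnA [(q + p)%N]addnC.
Qed.

Lemma raises_lin p a X Y : raises p X -> raises p Y -> raises p (a *: X + Y).
Proof.
move=> hX hY i Z hZ; rewrite mulmxDl -scalemxAl; apply: left_depthD; last exact: hY.
by apply/left_depthZ/hX.
Qed.

Lemma raises0 p : raises p 0.
Proof. by move=> i Z _; rewrite mul0mx; apply: left_depth_zero. Qed.

Lemma raisesB p X Y : raises p X -> raises p Y -> raises p (X - Y).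
Proof. by move=> hX hY; rewrite addrC -scaleN1r; apply: raises_lin. Qed.

Lemma raises_ad p q X Y : raises p X -> raises q Y -> raises (p + q) (mxad X Y).
Proof.
by move=> hX hY; apply: raisesB; [|rewrite addnC]; apply: raisesM.
Qed.

Lemma raises_vanish p X : (k <= p)%N -> raises p X -> X = 0.
Proof.
move=> kp /(_ 0%N 1 (left_depth0 _ _)); rewrite mulmx1 => hX.
exact: (left_depth_vanish Ek) (left_depthW kp hX).
Qed.

Lemma raises_centre z : in_centre mul z -> raises 0 (L z).
Proof.
move=> zC i Z; rewrite addn0; elim=> {i Z} [Z|X Z i XE _ IH|i|i Z Z' _ IH _ IH'].
- exact: left_depth0.
- have /EP[x _ EX] := XE; rewrite -[X * Z]/(X *m Z) mulmxA EX lmx_centreC // -mulmxA -EX.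
  exact: left_depthS.
- by rewrite mulmx0; apply: left_depth_zero.
by rewrite mulmxDr; apply: left_depthD.
Qed.

Lemma raises_nil_part x : x \in V -> raises 1 (L (nil_part x)).
Proof.
move=> xV i Z hZ; rewrite addn1; apply: left_depthS => //; apply/EP.
by exists x.
Qed.

(** An element of [V] has positive degree only up to a central summand, which brackets do not
    see. *)
Definition raises_mod_centre p x := exists2 z, in_centre mul z & raises p (L (x - z)).

Lemma raises_mod_centre_V x : x \in V -> raises_mod_centre 1 x.
Proof.
move=> xV; exists (ss_part x); first exact/QC/ss_part_Q.
exact: raises_nil_part.
Qed.

Lemma raises_trip p q r x y z : x \in V -> y \in V -> z \in V ->
  raises_mod_centre p x -> raises_mod_centre q y -> raises_mod_centre r z ->
  raises (p + q + r) (L (trip mul x y z)).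
Proof.
move=> xV yV zV [x0 x0C hx] [y0 y0C hy] [z0 z0C hz]; rewrite lmx_tripV //.
have adC u w : in_centre mul w -> mxad (L u) (L w) = 0.
  by move=> wC; rewrite /mxad (lmx_centreC u wC) subrr.
suff -> : mxad (mxad (L x) (L y)) (L z) =
    mxad (mxad (L (x - x0)) (L (y - y0))) (L (z - z0)).
  by apply: raises_ad => //; apply: raises_ad.
have -> : mxad (L (x - x0)) (L (y - y0)) = mxad (L x) (L y).
  rewrite (lmxB y) mxadB (adC _ _ y0C) subr0 mxadC lmxB mxadB (adC _ _ x0C) subr0.
  by rewrite -mxadC.
by rewrite (lmxB z) mxadB (mxad_jacobi _ _ (L z0)) !(adC _ _ z0C) !mxad0 !subr0.
Qed.

(** Degrees add in triple products even modulo the centre, and a combination of triple products has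
    no central part left; hence the stronger clause from the first step on. *)
Lemma lcs_raises m x : x \in lcs mul V m ->
  [/\ x \in V, raises_mod_centre m.+1 x & (0 < m)%N -> raises m.+1 (L x)].
Proof.
elim: m x => [|m IH] x /=; first by move=> xV; split=> //; apply: raises_mod_centre_V.
pose R y := y \in V /\ raises m.+2 (L y).
have Rlin a y z : R y -> R z -> R (a *: y + z).
  move=> [yV hy] [zV hz]; split; first by rewrite rpredD ?rpredZ.
  by rewrite lmxP; apply: raises_lin.
have R0 : R 0 by split; [exact: mem0v | rewrite lmx0; exact: raises0].
suff Rx y : y \in (tspan mul (lcs mul V m) V V + tspan mul V V (lcs mul V m))%VS -> R y.
  case/Rx => xV hx; split=> //; exists 0; [exact: centre0 | by rewrite subr0].
have Rspan (U1 U2 U3 : {vspace A}) : (forall a b c, a \in U1 -> b \in U2 -> c \in U3 -> R (trip mul a b c)) ->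
    forall w, w \in tspan mul U1 U2 U3 -> R w.
  move=> h w; apply: span_ind => // u /flattenP[_ /mapP[c hc ->] /allpairsP[[a b] /= [ha hb ->]]].
  by apply: h; apply: vbasis_mem.
case/memv_addP=> y1 h1 [y2 h2 ->]; rewrite -[y1]scale1r; apply: Rlin.
  apply: Rspan h1 => a b c ha hb hc; have [aV Ha _] := IH a ha.
  split; first exact: hVsub.
  apply: raisesW (raises_trip aV hb hc Ha (raises_mod_centre_V hb) (raises_mod_centre_V hc)).
  by rewrite !addn1.
apply: Rspan h2 => a b c ha hb hc; have [cV Hc _] := IH c hc.
split; first exact: hVsub.
apply: raisesW (raises_trip ha hb cV (raises_mod_centre_V ha) (raises_mod_centre_V hb) Hc).
by rewrite addnC addn2.
Qed.

Lemma lts_nilpotentV : lts_nilpotent mul V.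
Proof.
exists k.+1; apply/eqP; rewrite -subv0; apply/subvP => x /lcs_raises[_ _ /(_ isT) hx].
by rewrite memv0; apply/eqP/lmx_inj; rewrite lmx0; apply: raises_vanish hx; apply: leqW.
Qed.

(** The weight counts the leaves of an iterated triple product. Such a product is again some
    [nil_part x], whose degree cannot be read off from the element, so it is carried as an index. *)
Inductive weighted_letter : nat -> A -> Prop :=
| weighted_letter1 x : x \in V -> weighted_letter 1 (nil_part x)
| weighted_letter_trip i a j b l c : weighted_letter i a -> weighted_letter j b ->
    weighted_letter l c -> weighted_letter (i + j + l) (trip mul a b c).

Lemma nil_part_LNalt x : x \in V -> in_LNalt mul (nil_part x).
Proof.
move=> xV; rewrite /nil_part addrC -scaleN1r; apply: LNalt_lin; last exact: hVLN.
exact/centre_LNalt/QC/ss_part_Q.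
Qed.

Lemma nil_part_comm x y : x \in V -> y \in V ->
  mul (nil_part x) (nil_part y) = mul (nil_part y) (nil_part x).
Proof.
move=> xV yV; apply: (can_inj cvK); apply/eqP; rewrite -subr_eq0.
rewrite -(lmxE (nil_part x)) -(lmxE (nil_part y)).
rewrite -(lmx1 (nil_part x)) -(lmx1 (nil_part y)) !mulmxA -mulmxBl.
rewrite -/(mxad _ _) mxad_nil_part mxadC mxad_nil_part.
by rewrite -mxadC /mxad mulmxBl -!mulmxA !lmx1 !lmxE (hVcomm xV yV) subrr.
Qed.

Lemma weighted_letter_nil_part w b : weighted_letter w b ->
  exists2 x, x \in V & b = nil_part x.
Proof.
elim=> {w b} [x xV|i a j b l c _ [x xV ->] _ [y yV ->] _ [z zV ->]]; first by exists x.
exists (trip mul x y z); first exact: hVsub.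
rewrite nil_part_trip //; apply: lmx_inj; rewrite -(lmx_trip_nil_part xV yV zV).
by apply: lmx_trip; first [exact: nil_part_LNalt | exact: nil_part_comm].
Qed.

Lemma weighted_letter_LNalt w b : weighted_letter w b -> in_LNalt mul b.
Proof. by case/weighted_letter_nil_part=> x xV ->; exact: nil_part_LNalt. Qed.

Lemma weighted_letter_comm i a j b : weighted_letter i a -> weighted_letter j b ->
  mul a b = mul b a.
Proof.
move=> /weighted_letter_nil_part[x xV ->] /weighted_letter_nil_part[y yV ->].
exact: nil_part_comm.
Qed.

Lemma weighted_letter_raises w b : weighted_letter w b -> raises w (L b).
Proof.
elim=> {w b} [x xV|i a j b l c ha IHa hb IHb hc IHc]; first exact: raises_nil_part.
rewrite (lmx_trip (weighted_letter_LNalt ha) (weighted_letter_LNalt hb)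
  (weighted_letter_comm ha hb) (weighted_letter_comm hb hc) (weighted_letter_comm ha hc)).
by apply: raises_ad => //; apply: raises_ad.
Qed.

Local Notation wspan := (word_span weighted_letter).

Lemma wspan_raises p m X : wspan p m X -> raises p X.
Proof.
elim=> {p m X} [z zC|w b p m X hb _ IH|p m|a p m X Y _ IHX _ IHY|p p' m m' X pp _ _ IH].
- exact: raises_centre.
- by apply: raisesM => //; exact: weighted_letter_raises.
- exact: raises0.
- exact: raises_lin.
exact: raisesW IH.
Qed.

Lemma wspan_lmx p m X x : wspan p m X -> cv x = X *m v -> wspan p m (L x).
Proof.
exact: (word_span_lmx weighted_letter_LNalt weighted_letter_comm weighted_letter_trip).
Qed.

Lemma wspan_nil_part x : x \in V -> wspan 1 1 (L (nil_part x)).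
Proof. by move=> xV; apply/word_span_letter/weighted_letter1. Qed.

Lemma wspan_full x : exists m, wspan 0 m (L x).
Proof.
apply: (word_span_full weighted_letter_LNalt weighted_letter_comm weighted_letter_trip hgen) => y yV.
exists 1%N; have -> : y = nil_part y + ss_part y by rewrite /nil_part subrK.
rewrite lmxD; apply: word_spanD.
  by apply: word_spanW (wspan_nil_part yV).
apply: word_spanW (word_span_centre _ _) => //; exact/QC/ss_part_Q.
Qed.

Lemma wspan_mul p m q l x y : wspan p m (L x) -> wspan q l (L y) ->
  wspan (p + q) (m + l) (L (mul x y)).
Proof.
by move=> hx hy; apply: wspan_lmx (word_spanM hx hy) _; rewrite -mulmxA lmx1 lmxE.
Qed.

(** R consists of the [x] whose [L x] is a sum of words of weight at least 1. Weights add under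
    [mul] by [wspan_mul], and a weight of at least [k] forces 0. In the intersection with [Q] the
    powers of [L x] gain degree, so [L x] is nilpotent and [Qred] applies. *)
Lemma nilpotent_ideal_complement : exists R : {vspace A},
  [/\ (Q + R)%VS = fullv, (Q :&: R)%VS = 0%VS, is_ideal mul R & alg_nilpotent mul R].
Proof.
have [|a x y [m hm] [l hl]|R hR] := @vspace_of_pred F A (fun x => exists m, wspan 1 m (L x)).
- by exists 0%N; rewrite lmx0; apply: word_span0.
- exists (maxn m l); rewrite lmxP; apply: word_span_lin.
    by apply: word_spanW hm => //; apply: leq_maxl.
  by apply: word_spanW hl => //; apply: leq_maxr.
have Rideal : is_ideal mul R.
  move=> r x /hR[m hm]; have [l hl] := wspan_full x; split; apply/hR.
    by exists (m + l)%N; apply: (wspan_mul hm hl).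
  by exists (l + m)%N; apply: (wspan_mul hl hm).
exists R; split=> //.
- apply: hgen => [||x y].
  + by rewrite -[one]addr0 memv_add // mem0v.
  + apply/subvP => x xV; have -> : x = ss_part x + nil_part x by rewrite /nil_part addrC subrK.
    apply: memv_add; first exact: ss_part_Q.
    by apply/hR; exists 1%N; apply: wspan_nil_part.
  move=> /memv_addP[q qQ [r rR ->]] /memv_addP[q' qQ' [r' rR' ->]].
  rewrite mulDl !mulDr -addrA; apply: memv_add; first exact: QM.
  by rewrite !rpredD //; [have [] := Rideal _ q rR' | have [] := Rideal _ q' rR | have [] := Rideal _ r' rR].
- apply/eqP; rewrite -subv0; apply/subvP => x; rewrite memv_cap => /andP[xQ /hR[m hm]].
  rewrite memv0; apply/eqP; apply: Qred => //; exists k.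
  have xr : raises k (L x ^+ k).
    elim: k => [|j IH]; first by move=> i Z; rewrite addn0 expr0 mul1mx.
    by rewrite exprS -add1n; apply: raisesM => //; exact: wspan_raises hm.
  exact: raises_vanish xr.
(* The successor, because the length must be positive and [k] may be 0. *)
exists k.+1; split=> // x xk.
suff [m hm] : exists m, wspan k.+1 m (L x).
  by apply: lmx_inj; rewrite lmx0; apply: raises_vanish (wspan_raises hm); apply: leqnSn.
elim: xk => {x} [r /hR //|i j x y _ [m hm] _ [l hl]].
by exists (m + l)%N; apply: wspan_mul.
Qed.

Lemma Q_no_nonzero_nilpotents : no_nonzero_nilpotents mul Q.
Proof.
(* [rpow q j] is the power with [j.+1] factors. *)
move=> q qQ [j qj]; apply: Qred => //; exists j.+1.
rewrite -lmx0 -qj; elim: j {qj} => [|j IH] /=; first by rewrite expr1.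
by rewrite exprS IH lmx_centre //; exact: QC.
Qed.

End Depth.
End Decomposition.

Lemma nilpotent_decomposition : lts_nilpotent mul V /\
  exists Q R : {vspace A},
    (Q + R)%VS = fullv /\ (Q :&: R)%VS = 0%VS /\
    is_ideal mul R /\ alg_nilpotent mul R /\
    mul_closed mul Q /\ (forall q, q \in Q -> in_centre mul q) /\
    no_nonzero_nilpotents mul Q.
Proof.
have [s_ hs] : exists s_ : 'I_(\dim V) -> A, forall i : 'I_(\dim V), [/\ in_centre mul (s_ i),
    exists2 q : {poly F}, separable_poly q & horner_mx (L (s_ i)) q = 0 &
    exists k, L ((vbasis V)`_i - s_ i) ^+ k = 0].
  apply: (@fin_all_exists 'I_(\dim V) (fun=> A) (fun i s => [/\ in_centre mul s,
    exists2 q : {poly F}, separable_poly q & horner_mx (L s) q = 0 &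
    exists k, L ((vbasis V)`_i - s) ^+ k = 0])) => i; apply: central_semisimple_part.
  by rewrite vbasis_mem // mem_nth // size_tuple.
have [||Q [Qone sQ QM QC Qred]] := @semisimple_subalgebra _ s_; try by move=> i; case: (hs i).
have sNil (i : 'I_(\dim V)) : exists k, L ((vbasis V)`_i - s_ i) ^+ k = 0 by case: (hs i).
have [k hk] := nil_part_words_vanish sNil sQ QC Qred.
have [|a _ _ [x xV ->] [y yV ->]|E EP] := @vspace_of_pred F _
  (fun X => exists2 x, x \in V & X = L (nil_part s_ x)).
- by exists 0; [exact: mem0v | rewrite nil_part0 lmx0].
- by exists (a *: x + y); [rewrite rpredD ?rpredZ | rewrite nil_partP lmxP].
have Ek : words_vanish (fun X => X \in E) k by apply: words_vanishW hk => X /EP.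
split; first exact: (lts_nilpotentV sQ QC EP Ek).
have [R [QR QR0 RI RN]] := nilpotent_ideal_complement sNil sQ Qone QM QC Qred EP Ek.
exists Q, R; do 6!split => //; exact: Q_no_nonzero_nilpotents.
Qed.

End GeneratingSystem.
End LeftMultiplications.

(** * Choice of coordinates and conclusion *)

Lemma column_coordinates (F : fieldType) (A : vectType F) n : \dim {:A} = n ->
  exists (cv : {linear A -> 'cV[F]_n}) (vc : 'cV[F]_n -> A),
    cancel cv vc /\ cancel vc cv.
Proof.
move=> <-; pose f (x : A) := \col_i coord (vbasis {:A}) i x.
have flin : linear f by move=> a x y; apply/colP => i; rewrite !mxE linearP.
pose fL := GRing.isLinear.Build F _ _ _ f flin.
pose cv : {linear A -> 'cV[F]_(\dim {:A})} := HB.pack f fL.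
exists cv, (fun u : 'cV_(\dim {:A}) => \sum_(i < \dim {:A}) u i 0 *: (vbasis {:A})`_i); split=> x /=.
  rewrite [RHS](coord_vbasis (memvf x)).
  by apply: eq_bigr => i _; rewrite mxE.
apply/colP => i; rewrite mxE coord_sum_free //.
exact: basis_free (vbasisP _).
Qed.

Unset Implicit Arguments.

Theorem theorem1p2 (F : fieldType) (A : vectType F) (mul : A -> A -> A) (one : A)
  (hchar : [pchar F] =i pred0)
  (hbil : bilinear_mul mul) (hone : is_unit_elt mul one)
  (V : {vspace A})
  (hVLN : forall a, a \in V -> in_LNalt mul a)
  (hVsub : forall a b c, a \in V -> b \in V -> c \in V -> trip mul a b c \in V)
  (hVcomm : forall a b, a \in V -> b \in V -> mul a b = mul b a)
  (hgen : generates_unital mul one V) :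
  lts_nilpotent mul V /\
  exists Q R : {vspace A},
    (Q + R)%VS = fullv /\ (Q :&: R)%VS = 0%VS /\
    is_ideal mul R /\ alg_nilpotent mul R /\
    mul_closed mul Q /\ (forall q, q \in Q -> in_centre mul q) /\
    no_nonzero_nilpotents mul Q.
Proof.
(* Matrices form a nonzero ring only in positive size, so the zero algebra is treated apart. *)
case Edim: (\dim {:A}) => [|n]; last first.
  have [cv [vc [cvK vcK]]] := column_coordinates Edim.
  exact: (nilpotent_decomposition hchar hbil hone cvK vcK hVLN hVsub hVcomm hgen).
have full0 : {:A}%VS = 0%VS by apply/eqP; rewrite -dimv_eq0 Edim.
have all0 (x : A) : x = 0 by apply/eqP; rewrite -memv0 -full0 memvf.
have vs0 (U : {vspace A}) : U = 0%VS.
  by apply/eqP; rewrite -subv0 -full0 subvf.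
split; first by exists 0%N; apply: vs0.
exists 0%VS, 0%VS; rewrite full0 add0v cap0v; do 2!split=> //.
split; first by move=> r x _; rewrite !memv0 (all0 (mul r x)) (all0 (mul x r)).
split; first by exists 1%N; split=> // x _; exact: all0.
split; first by move=> x y _ _; rewrite memv0 (all0 (mul x y)).
split; last by move=> q _ _; exact: all0.
by move=> q _ x y; split; [|split; [|split]]; rewrite ?(all0 (mul _ _)) ?(all0 (assoc _ _ _ _)).
Qed.
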